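(* Let $G_1$ and $G_2$ be graphs, $G_i$ having $n_i$ nodes and node connectivity $k_i$, and let $n_{s1},n_{s2}$ be positive integers with $n_1n_{s1}=n_2n_{s2}$. Take $n_{si}$ copies of each node of $G_i$ ($i=1,2$), choose a uniformly random perfect matching between the $n_1n_{s1}$ copies from $G_1$ and the $n_2n_{s2}$ copies from $G_2$, and place an interdependence edge between the original nodes of each matched pair, so that each node of $G_i$ is supported by $n_{si}$ nodes of $G_j$ (counted with multiplicity). Then for $i,j\in\{1,2\}$, $i\neq j$: if $k_in_{si}=\omega(\log(n_in_{si}))$, the supply node connectivity of $G_i$ is $\Theta(\min(k_in_{si},n_j))$ with high probability; if, in addition, $k_in_{si}=\omega(n_j)$, then for any constant $\epsilon>0$ the supply node connectivity of $G_i$ is at least $(1-\epsilon)n_j$ with high probability.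
   Context: The supply nodes of a node $v$ of $G_i$ are the nodes of $G_j$ joined to $v$ by interdependence edges; $v$ fails if all its supply nodes are removed. A node cut of a graph is a set of nodes whose removal either leaves more than one connected component or leaves exactly one node. A supply node cut of $G_i$ is a set $W$ of nodes of $G_j$ such that the set of nodes of $G_i$ all of whose supply nodes lie in $W$ contains a node cut of $G_i$; the supply node connectivity of $G_i$ is the minimum size of a supply node cut. Asymptotics are as the graph sizes tend to infinity; ''with high probability'' means with probability $1-o(1)$. *)

(* Defs.v *)
From HB Require Import structures.
From mathcomp Require Import all_boot all_order all_algebra.
From mathcomp Require Import all_classical all_reals all_analysis.

Set Implicit Arguments.
Unset Strict Implicit.
Unset Printing Implicit Defensive.

Import Order.TTheory GRing.Theory Num.Theory.
Import numFieldNormedType.Exports.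

Local Open Scope nat_scope.

Record sgraph := SGraph {
  vertex :> finType;
  edge : rel vertex;
  edge_sym : symmetric edge;
  edge_irr : irreflexive edge
}.

Section BigMin.
Variables (T : finType) (P : pred {set T}).
Let m := \big[minn/#|T|]_(A : {set T} | P A) #|A|.

Lemma bigminn_card_le A : P A -> m <= #|A|.
Proof.
move=> PA; rewrite /m; have : A \in index_enum {set T} by rewrite mem_index_enum.
elim: (index_enum _) => // B s IH; rewrite inE big_cons.
case/predU1P => [<-|/IH les]; first by rewrite PA geq_minl.
by case: ifP => // _; rewrite geq_min les orbT.
Qed.

Lemma bigminn_card_ex A : P A -> exists2 B, P B & #|B| = m.
Proof.
move=> PA; have : m = #|T| \/ exists2 B, P B & #|B| = m.
  rewrite /m; elim/big_ind: _ => [|x y Hx Hy|B PB]; first by left.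
    by case: (leqP x y) => _.
  by right; exists B.
case=> // mT; exists A => //.
by apply/eqP; rewrite eqn_leq bigminn_card_le // mT max_card.
Qed.

End BigMin.

Section Connectivity.
Variable G : sgraph.

Definition edge_del (C : {set G}) : rel G :=
  [rel x y | [&& x \notin C, y \notin C & edge x y]].

Definition node_cut (C : {set G}) : bool :=
  (1 < n_comp (edge_del C) (~: C)) || (#|~: C| == 1).

(* The default value #|G| plays no role for nonempty G, by
   node_connectivity_ex below. *)
Definition node_connectivity : nat :=
  \big[minn/#|G|]_(C : {set G} | node_cut C) #|C|.

Lemma node_cutC1 (x : G) : node_cut (~: [set x]%SET).
Proof. by rewrite /node_cut finset.setCK cards1 eqxx orbT. Qed.

Lemma node_connectivity_le C : node_cut C -> node_connectivity <= #|C|.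
Proof. exact: bigminn_card_le. Qed.

Lemma node_connectivity_ex :
  0 < #|G| -> exists2 C, node_cut C & #|C| = node_connectivity.
Proof. by case/card_gt0P => x _; exact: bigminn_card_ex (node_cutC1 x). Qed.

End Connectivity.

Section Supply.
(* [dep v w] holds when an interdependence edge joins v and w. *)
Variables (G : sgraph) (T : finType) (dep : G -> T -> bool).

Definition supply_nodes (v : G) : {set T} := [set w | dep v w]%SET.

Definition failed_nodes (W : {set T}) : {set G} :=
  [set v | supply_nodes v \subset W]%SET.

Definition supply_node_cut (W : {set T}) : bool :=
  [exists C : {set G}, node_cut C && (C \subset failed_nodes W)].

(* Likewise for #|T| here, by supply_node_connectivity_ex below. *)
Definition supply_node_connectivity : nat :=
  \big[minn/#|T|]_(W : {set T} | supply_node_cut W) #|W|.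

Lemma supply_node_connectivity_le W :
  supply_node_cut W -> supply_node_connectivity <= #|W|.
Proof. exact: bigminn_card_le. Qed.

Lemma supply_node_connectivity_ex :
  0 < #|G| -> exists2 W, supply_node_cut W & #|W| = supply_node_connectivity.
Proof.
case/card_gt0P => x _; apply: (bigminn_card_ex (A := [set: T]%SET)).
apply/existsP; exists (~: [set x]%SET); rewrite node_cutC1 /=.
by apply/fintype.subsetP => v _; rewrite inE finset.subsetT.
Qed.

End Supply.

Section RandomMatching.
Variables (G1 G2 : sgraph) (s1 s2 : nat).

Definition copies (G : sgraph) (s : nat) : finType := (G * 'I_s)%type.

Definition matching : finType := {set copies G1 s1 * copies G2 s2}.

Definition perfect_matching (M : matching) : bool :=
  [forall a, #|[set b | (a, b) \in M]%SET| == 1] &&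
  [forall b, #|[set a | (a, b) \in M]%SET| == 1].

Definition interdep (M : matching) (v : G1) (w : G2) : bool :=
  [exists a : 'I_s1, exists b : 'I_s2, ((v, a), (w, b)) \in M].

Definition supply_conn1 (M : matching) : nat :=
  supply_node_connectivity (interdep M).

Definition supply_conn2 (M : matching) : nat :=
  supply_node_connectivity (fun w v => interdep M v w).

(* Probability of the event E under the uniform distribution on perfect
   matchings. *)
Definition matching_prob (R : realType) (E : pred matching) : R :=
  (#|[set M | perfect_matching M & E M]%SET|%:R /
   #|[set M | perfect_matching M]%SET|%:R)%R.

End RandomMatching.

Arguments supply_conn1 {G1 G2 s1 s2} M.
Arguments supply_conn2 {G1 G2 s1 s2} M.

Local Open Scope ring_scope.
Local Open Scope classical_set_scope.

Definition little_omega (R : realType) (f g : nat -> R) : Prop :=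
  (g : nat -> R^o) =o_\oo (f : nat -> R^o).

Lemma little_omegaP (R : realType) (f g : nat -> R) :
  little_omega f g <->
  forall e : R, 0 < e -> \forall t \near \oo, `|g t| <= e * `|f t|.
Proof. exact: eqoP. Qed.

Definition whp (R : realType) (G1 G2 : nat -> sgraph) (s1 s2 : nat -> nat)
    (E : forall t, pred (matching (G1 t) (G2 t) (s1 t) (s2 t))) : Prop :=
  matching_prob R (E t) @[t --> \oo] --> (1 : R).

Arguments whp R G1 G2 s1 s2 E : clear implicits.

(* Main.v *)
Require Import Defs.
From mathcomp Require Import all_boot all_order all_algebra fingroup perm.
From mathcomp Require Import zify ring lra.

(** Fix a set [W] of [G_j]. The copies of nodes of [G_i] matched outside [W] form
    a uniformly random set [U] of copies, and if [W] is a supply node cut then [U]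
    lies in two nonadjacent parts of the blow-up of [G_i], in which every node is
    replaced by a clique of [n_si] copies; separators of the blow-up have size at
    least [K = k_i n_si]. So the core is a vertex sampling theorem: a random set
    containing a fixed proportion [p] of the [N] vertices of a graph without
    separators smaller than [K] is split with probability at most
    [2 N exp (- p^2 K / 256)].

    To prove it, first sample a dominating set [U0], then add vertices one at a
    time and follow the partition of [U0] into connected pieces. Around a piece
    [A] there are at least [K / 2] disjoint connectors, each either one vertex
    next to [A] and to another piece, or an edge [u w] with [u] next to [A] only
    and [w] next to other pieces only. A connector [u w] is ready when adding one
    more vertex to [U] merges [A] through it. If it is not ready for [U], then
    adding [u] leaves the partition unchanged and makes it ready. This injection
    between consecutive levels shows that, on average over two consecutive sizes
    of [U], a proportion of the connectors of each piece is ready, whence the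
    expected number of surplus pieces decays geometrically.

    For [k_i n_si = omega(n_j)] a union bound over all [2 ^ n_j] sets [W]
    suffices. In general one uses that supersets of supply node cuts are supply
    node cuts. The bound [min (k_i n_si, n_j)] from above holds for every perfect
    matching. *)

Set Implicit Arguments.
Unset Strict Implicit.
Unset Printing Implicit Defensive.

Import Order.TTheory GRing.Theory Num.Theory.

(** * Partitions of a dominating set traced by larger sets *)

Section Traces.
Variables (V : finType) (e : rel V).
Hypothesis e_sym : symmetric e.
Implicit Types (U A B : {set V}).

Definition induced (U : {set V}) : rel V :=
  [rel x y | [&& x \in U, y \in U & e x y]].

Definition nonadjacent (A B : {set V}) : bool :=
  [forall x in A, forall y in B, ~~ e x y].

Definition dominating (D : {set V}) : bool := [forall v, exists u in D, e v u].

Lemma nonadjacentP (A B : {set V}) :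
  reflect (forall x y, x \in A -> y \in B -> ~~ e x y) (nonadjacent A B).
Proof.
apply: (iffP forall_inP) => [h x y xA yB|h x xA].
  by move/forall_inP: (h x xA); apply.
by apply/forall_inP => y; apply: h.
Qed.

Lemma induced_connect_sym U : connect_sym (induced U).
Proof.
apply: sym_connect_sym => x y; rewrite /induced /= e_sym.
by case: (x \in U); case: (y \in U).
Qed.

Lemma sub_induced (U U' : {set V}) x y :
  U \subset U' -> connect (induced U) x y -> connect (induced U') x y.
Proof.
move=> /subsetP sU; apply: connect_sub => {}x {}y /and3P[xU yU xy].
by apply: connect1; rewrite /induced /= (sU _ xU) (sU _ yU).
Qed.

Lemma connect_invariant (T : eqType) (r : rel V) (f : V -> T) x y :
  (forall a b, r a b -> f a = f b) -> connect r x y -> f x = f y.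
Proof.
move=> fr /connectP[p]; elim: p x => [|z p IH] x /=; first by move=> _ ->.
by case/andP => /fr -> /IH h /h.
Qed.

Variable U0 : {set V}.

Definition component (U : {set V}) (x : V) : {set V} :=
  [set y in U0 | connect (induced U) x y].

(** When [U0] dominates and [U0 \subset U], every connected component of [U] meets [U0], so the
    classes stand for the components of [U]. Being subsets of the fixed set [U0], they can be
    compared for different [U]. *)
Definition trace (U : {set V}) : {set {set V}} := [set component U x | x in U0].

Definition adjacent_classes (U : {set V}) (v : V) : {set {set V}} :=
  [set component U x | x in U & e v x].

Lemma component_eq U x y : connect (induced U) x y -> component U x = component U y.
Proof.
move=> xy; apply/setP => z; rewrite !inE; congr (_ && _).
exact: (same_connect (@induced_connect_sym U) xy).
Qed.

Lemma component_edge U x y : x \in U -> y \in U -> e x y -> component U x = component U y.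
Proof. by move=> xU yU xy; apply: component_eq; apply: connect1; rewrite /induced /= xU yU. Qed.

Lemma mem_component U x : x \in U0 -> x \in component U x.
Proof. by move=> xU; rewrite inE xU connect0. Qed.

Lemma component_mem U x y : y \in component U x -> component U y = component U x.
Proof. by rewrite inE => /andP[_ /component_eq]. Qed.

Lemma component_trace U A a : A \in trace U -> a \in A -> component U a = A.
Proof. by case/imsetP => x _ ->; apply: component_mem. Qed.

Lemma trace_sub U A : A \in trace U -> A \subset U0.
Proof. by case/imsetP => x _ ->; apply/subsetP => y; rewrite inE => /andP[]. Qed.

Lemma trace_neq0 U A : A \in trace U -> A != set0.
Proof. by case/imsetP => x xU ->; apply/set0Pn; exists x; apply: mem_component. Qed.

Hypothesis dom : dominating U0.

Lemma dominatingE v : exists2 u, u \in U0 & e v u.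
Proof. by have /exists_inP := forallP dom v. Qed.

Section FixedU.
Variable U : {set V}.
Hypothesis sU : U0 \subset U.

Lemma component_in_trace x : x \in U -> component U x \in trace U.
Proof.
move=> xU; have [u uU0 xu] := dominatingE x; apply/imsetP; exists u => //.
by apply: component_edge => //; apply: (subsetP sU).
Qed.

Lemma adjacent_classes_sub v : adjacent_classes U v \subset trace U.
Proof.
by apply/subsetP => A /imsetP[x]; rewrite inE => /andP[xU _] ->; apply: component_in_trace.
Qed.

Lemma adjacent_classes_gt0 v : 0 < #|adjacent_classes U v|.
Proof.
have [u uU0 vu] := dominatingE v; apply/card_gt0P; exists (component U u).
by apply/imsetP; exists u; rewrite // inE (subsetP sU).
Qed.

Lemma card_traceU1 v :
  #|trace (v |: U)| + #|adjacent_classes U v| <= #|trace U| + 1.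
Proof.
set U' := v |: U; have sUU' : U \subset U' by apply: subsetU1.
(* [psi] sends a class of [U] to the class of [U'] containing it. It maps [trace U] onto [trace U']
   and collapses all classes adjacent to [v] to the class of [v]. *)
pose psi (B : {set V}) := \bigcup_(y in B) component U' y.
have psiE x : x \in U -> psi (component U x) = component U' x.
  move=> xU; have [u uU0 xu] := dominatingE x.
  have uU : u \in U by apply: (subsetP sU).
  rewrite (component_edge xU uU xu).
  rewrite (@component_edge U' x u) //; try exact: (subsetP sUU').
  apply/setP => z; apply/bigcupP/idP => [[y]|zu].
    rewrite inE => /andP[_ uy]; rewrite -(@component_eq U' u y) //.
    exact: sub_induced uy.
  by exists u => //; apply: mem_component.
have -> : trace U' = psi @: trace U.
  rewrite /trace -imset_comp; apply: eq_in_imset => x xU0 /=.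
  by rewrite psiE // (subsetP sU).
set Ad := adjacent_classes U v.
have sAd : Ad \subset trace U by apply: adjacent_classes_sub.
have : psi @: trace U \subset component U' v |: psi @: (trace U :\: Ad).
  apply/subsetP => _ /imsetP[B BU ->]; rewrite !inE.
  have [BAd|BAd] := boolP (B \in Ad); last first.
    by apply/orP; right; apply: imset_f; rewrite inE BAd.
  move: BAd => /imsetP[x]; rewrite inE => /andP[xU vx] ->.
  rewrite psiE // (@component_edge U' v x) ?eqxx //; first by rewrite setU11.
  exact: (subsetP sUU').
move/subset_leq_card => h.
have h1 := leq_imset_card psi (trace U :\: Ad).
have h2 : #|component U' v |: psi @: (trace U :\: Ad)| <= #|psi @: (trace U :\: Ad)|.+1.
  by rewrite cardsU1; case: (_ \notin _).
have h3 := cardsD (trace U) Ad.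
have h4 : #|trace U :&: Ad| = #|Ad| by congr #|pred_of_set _|; apply/setIidPr.
have h5 := subset_leq_card sAd.
rewrite h4 in h3; unfold reverse_coercion in *; lia.
Qed.

Lemma traceU1_eq A v :
  adjacent_classes U v = [set A] -> trace (v |: U) = trace U.
Proof.
move=> hA; set U' := v |: U; apply: eq_in_imset => x xU0.
have xU := subsetP sU x xU0.
(* The class map of [U], extended by giving [v] the class [A], is constant along the edges induced
   by [U']; hence no two classes merge. *)
pose f y := if y \in U then component U y else A.
have fE a b : induced U' a b -> f a = f b.
  have vA y : y \in U -> e v y -> component U y = A.
    move=> yU vy; apply/set1P; rewrite -hA; apply/imsetP; exists y => //.
    by rewrite inE yU.
  rewrite /f => /and3P[]; rewrite !inE.
  have [aU|aU] := boolP (a \in U); have [bU|bU] := boolP (b \in U); rewrite ?orbF //.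
  - by move=> _ _; apply: component_edge.
  - by move=> _ /eqP ->; rewrite e_sym => /(vA _ aU).
  - by move=> /eqP -> _ /(vA _ bU) ->.
apply/setP => y; rewrite !inE; case yU0: (y \in U0) => //=.
apply/idP/idP; last by apply: sub_induced; apply: subsetU1.
move/(connect_invariant fE); rewrite /f xU (subsetP sU _ yU0) => xy.
by have := mem_component U yU0; rewrite -xy inE yU0.
Qed.

Definition connecting (A : {set V}) : {set V} :=
  [set v | [&& v \notin U, A \in adjacent_classes U v & 1 < #|adjacent_classes U v|]].

(** Double counting: a vertex with [c >= 2] adjacent classes is connecting for [c] of them, and
    [c <= 2 * (c - 1)]. *)
Lemma sum_connecting :
  \sum_(A in trace U) #|connecting A| <=
  2 * \sum_(v in ~: U) (#|adjacent_classes U v| - 1).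
Proof.
have -> : \sum_(A in trace U) #|connecting A| =
   \sum_(v in ~: U | 1 < #|adjacent_classes U v|) #|adjacent_classes U v|.
  under eq_bigr do rewrite -sum1_card.
  under [RHS]eq_bigr do rewrite -sum1_card.
  rewrite (exchange_big_dep (fun v => (v \in ~: U) && (1 < #|adjacent_classes U v|))) /=.
    apply: eq_bigr => v /andP[]; rewrite inE => vU h1; apply: eq_bigl => A.
    rewrite !inE vU h1 andbT /=; apply: andb_idl.
    exact: (subsetP (adjacent_classes_sub v)).
  by move=> A v _; rewrite !inE => /and3P[-> _ ->].
rewrite big_distrr /= big_mkcondr /=; apply: leq_sum => v _.
by case: ifP => //; lia.
Qed.

End FixedU.
End Traces.

(** * The switching argument *)

Section Switching.
Variables (V : finType) (e : rel V).
Hypotheses (e_sym : symmetric e) (e_refl : reflexive e).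
Implicit Types (U A B : {set V}) (pi : {set {set V}}).

Variable K : nat.
Hypothesis separatorP : forall A B,
  A != set0 -> B != set0 -> nonadjacent e A B -> K <= #|~: (A :|: B)|.

Variable U0 : {set V}.
Hypothesis dom : dominating e U0.

Local Notation component := (component e U0).
Local Notation trace := (trace e U0).
Local Notation connecting := (connecting e U0).
Local Notation adjacent_classes := (adjacent_classes e U0).

Definition touching A : {set V} := [set v | [exists a in A, e v a]].

Lemma touchingP A v : reflect (exists2 a, a \in A & e v a) (v \in touching A).
Proof. by rewrite inE; apply: exists_inP. Qed.

Section FixedClass.
Variable A : {set V}.

(** The sides depend on [A] and [U0] only, so one family of connectors serves all [U] whose trace
    contains [A]. *)
Definition both_sides := touching A :&: touching (U0 :\: A).
Definition near_side := touching A :\: touching (U0 :\: A).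
Definition far_side := touching (U0 :\: A) :\: touching A.

Definition is_matching (M : {set V * V}) : bool :=
  [forall p in M, [&& p.1 \in near_side, p.2 \in far_side & e p.1 p.2]] &&
  [forall p in M, forall q in M, ((p.1 == q.1) || (p.2 == q.2)) ==> (p == q)].

Lemma is_matchingP (M : {set V * V}) :
  reflect ((forall p, p \in M -> [/\ p.1 \in near_side, p.2 \in far_side & e p.1 p.2])
    /\ (forall p q, p \in M -> q \in M -> p.1 = q.1 \/ p.2 = q.2 -> p = q))
    (is_matching M).
Proof.
apply: (iffP andP) => -[h1 h2]; split.
- by move=> p pM; apply/and3P; apply: (forall_inP h1).
- move=> p q pM qM pq; apply/eqP.
  have /forall_inP/(_ q qM)/implyP := forall_inP h2 p pM; apply.
  by apply/orP; case: pq => ->; [left|right].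
- by apply/forall_inP => p /h1 H; apply/and3P.
- apply/forall_inP => p pM; apply/forall_inP => q qM; apply/implyP => pq.
  by apply/eqP; apply: h2 => //; case/orP: pq => /eqP; [left|right].
Qed.

(* A maximal matching between the two sides covers every edge between them,
   so its endpoints together with the common neighbours separate [A] from
   [U0 :\: A]; this replaces Menger's theorem at the cost of a factor 2. *)
Lemma exists_large_matching :
  A \subset U0 -> A != set0 -> U0 :\: A != set0 -> nonadjacent e A (U0 :\: A) ->
  exists2 M, is_matching M & K <= #|both_sides| + 2 * #|M|.
Proof.
move=> sA A0 B0 /nonadjacentP nAB.
have m0 : is_matching set0.
  by apply/is_matchingP; split=> [p|p q]; rewrite inE.
case: (@arg_maxnP _ set0 is_matching (fun M => #|M|) m0) => M mM Mmax.
exists M => //; have [M1 M2] := is_matchingP _ mM.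
set P' := near_side :\: (fst @: M); set Q' := far_side :\: (snd @: M).
have aP a : a \in A -> a \in near_side.
  move=> aA; rewrite in_setD; apply/andP; split; last by apply/touchingP; exists a.
  by apply/touchingP => -[b bB]; apply/negP; apply: nAB.
have bQ b : b \in U0 :\: A -> b \in far_side.
  move=> bB; rewrite in_setD; apply/andP; split; last by apply/touchingP; exists b.
  by apply/touchingP => -[a aA]; apply/negP; rewrite e_sym; apply: nAB.
(* No vertex of [A] is matched by [M]: its partner would be in [far_side] and yet touch [A]. The
   same holds for [U0 :\: A]. *)
have P0 : P' != set0.
  case/set0Pn: A0 => a aA; apply/set0Pn; exists a; rewrite in_setD (aP a aA) andbT.
  apply/imsetP => -[p pM ap]; have [_ + e12] := M1 p pM.
  by rewrite in_setD => /andP[/touchingP[]]; exists a; rewrite // e_sym ap.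
have Q0 : Q' != set0.
  case/set0Pn: B0 => b bB; apply/set0Pn; exists b; rewrite in_setD (bQ b bB) andbT.
  apply/imsetP => -[p pM bp]; have [+ _ e12] := M1 p pM.
  by rewrite in_setD => /andP[/touchingP[]]; exists b; rewrite // bp.
have nPQ : nonadjacent e P' Q'.
  apply/nonadjacentP => u w /setDP[uP uM] /setDP[wQ wM].
  apply/negP => uw.
  (* An edge between the unmatched vertices of the two sides could be added to [M], against
     maximality. *)
  have uwM : (u, w) \notin M.
    by apply: contra uM => uwM; apply/imsetP; exists (u, w).
  have : is_matching ((u, w) |: M).
    apply/is_matchingP; split => [p|p q].
      by case/setU1P => [->|/M1]; [split|].
    have aux r : r \in M -> ~ (u = r.1 \/ w = r.2).
      move=> rM [ur|wr]; [move/negP: uM|move/negP: wM]; apply.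
        by apply/imsetP; exists r.
      by apply/imsetP; exists r.
    case/setU1P => [->|pM]; case/setU1P => [->|qM] //=.
    - by move/aux; case.
    - by move=> pu; case: (aux p pM); case: pu => ->; [left|right].
    - exact: M2.
  by move/Mmax; rewrite /= cardsU1 uwM /= add1n ltnn.
apply: leq_trans (separatorP P0 Q0 nPQ) _.
have : ~: (P' :|: Q') \subset both_sides :|: (fst @: M :|: snd @: M).
  apply/subsetP => v; have [u uU0 vu] := dominatingE dom v.
  have : (v \in touching A) || (v \in touching (U0 :\: A)).
    have [uA|uA] := boolP (u \in A); apply/orP; [left|right]; apply/touchingP; exists u => //.
    by rewrite in_setD uA.
  rewrite /P' /Q' /near_side /far_side /both_sides !(in_setU, in_setC, in_setD, in_setI).
  by do 4! case: (v \in _).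
move/subset_leq_card/leq_trans; apply.
have h1 := (leq_card_setU both_sides (fst @: M :|: snd @: M)).1.
have h2 := (leq_card_setU (fst @: M) (snd @: M)).1.
have h3 := leq_imset_card fst M; have h4 := leq_imset_card snd M.
move: h1 h2 h3 h4; unfold reverse_coercion; lia.
Qed.

Section Ready.
Variable U : {set V}.
Hypotheses (sU : U0 \subset U) (AU : A \in trace U).

Lemma touching_adjacent v : v \in touching A -> A \in adjacent_classes U v.
Proof.
case/touchingP => a aA va; apply/imsetP; exists a; last by rewrite (component_trace e_sym AU aA).
by rewrite inE va andbT (subsetP sU) // (subsetP (trace_sub AU)).
Qed.

Lemma componentD b : b \in U0 :\: A -> component U b != A.
Proof.
rewrite in_setD => /andP[bA bU0]; apply: contraNneq bA => <-.
exact: mem_component.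
Qed.

Lemma touchingD_adjacent v :
  v \in touching (U0 :\: A) -> exists2 B, B \in adjacent_classes U v & B != A.
Proof.
case/touchingP => b bB vb; exists (component U b); last exact: componentD.
apply/imsetP; exists b => //; move: bB; rewrite in_setD => /andP[_ bU0].
by rewrite inE vb (subsetP sU).
Qed.

Lemma component_touching v : v \in U -> v \in touching A -> component U v = A.
Proof.
move=> vU /touchingP[a aA va].
have aU : a \in U by rewrite (subsetP sU) // (subsetP (trace_sub AU)).
by rewrite (component_edge e_sym U0 vU aU va) (component_trace e_sym AU aA).
Qed.

Lemma component_touchingD v : v \in U -> v \in touching (U0 :\: A) -> component U v != A.
Proof.
move=> vU /touchingP[b bB vb]; have := componentD bB.
move: bB; rewrite in_setD => /andP[_ /(subsetP sU) bU].
by rewrite (component_edge e_sym U0 vU bU vb).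
Qed.

Lemma connectingI v B : v \notin U -> A \in adjacent_classes U v ->
  B \in adjacent_classes U v -> B != A -> v \in connecting U A.
Proof.
move=> vU Av Bv BA; rewrite inE vU Av /=; apply/card_gt1P.
by exists A, B; rewrite // eq_sym.
Qed.

(** Such a vertex cannot lie in [U], since it would already have merged [A] with another class. *)
Lemma both_sides_connecting : both_sides \subset connecting U A.
Proof.
apply/subsetP => v; rewrite in_setI => /andP[vA vB].
have [B Bv BA] := touchingD_adjacent vB.
apply: connectingI Bv BA; last exact: touching_adjacent.
apply/negP => vU; have := component_touchingD vU vB.
by rewrite component_touching // eqxx.
Qed.

(** Once [u] is in [U] it belongs to the piece of [A], so [w] sees both [A] and another class; it
    lies outside [U] because those classes are still distinct. *)
Lemma near_connecting u w : u \in near_side -> w \in far_side -> e u w ->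
  u \in U -> w \in connecting U A.
Proof.
rewrite !in_setD => /andP[_ uA] /andP[wnA wB] uw uU.
have [B Bw BA] := touchingD_adjacent wB; apply: connectingI Bw BA.
  apply/negP => wU; have := component_touchingD wU wB.
  by rewrite -(component_edge e_sym U0 uU wU uw) component_touching // eqxx.
by apply/imsetP; exists u; rewrite ?inE ?uU ?component_touching // e_sym.
Qed.

End Ready.

Definition ready U (p : V * V) := (p.1 \in connecting U A) || (p.2 \in connecting U A).

(** If [u] were in [U], then [w] would be connecting; if [u] saw a class other than [A], then [u]
    would be. So [u] is a new vertex seeing [A] only, and adding it makes [w] connecting. *)
Lemma ready_or_switch U u w : U0 \subset U -> A \in trace U ->
  u \in near_side -> w \in far_side -> e u w -> ~~ ready U (u, w) ->
  [/\ u \notin U, trace (u |: U) = trace U & ready (u |: U) (u, w)].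
Proof.
move=> sU AU uP wQ uw nr.
have uU : u \notin U.
  by apply: contra nr => uU; rewrite /ready (near_connecting sU AU uP wQ uw uU) orbT.
have uA : A \in adjacent_classes U u.
  by apply: touching_adjacent => //; move: uP; rewrite in_setD => /andP[].
have Eu : adjacent_classes U u = [set A].
  apply/setP => B; rewrite in_set1; apply/idP/eqP => [Bu|->] //; apply/eqP.
  apply: contraNT nr => BA; rewrite /ready /=.
  by rewrite (connectingI uU uA Bu BA).
have tE := traceU1_eq e_sym sU Eu; split=> //.
rewrite /ready /= orbC (@near_connecting _ _ _ u) ?setU11 ?tE //.
exact: subset_trans sU (subsetU1 _ _).
Qed.

(** Each ready pair has a connecting endpoint. These endpoints are distinct, as the pairs are
    disjoint and the two sides do not meet, and they avoid [both_sides]. *)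
Lemma card_ready (M : {set V * V}) U : is_matching M -> U0 \subset U -> A \in trace U ->
  #|both_sides| + #|[set p in M | ready U p]| <= #|connecting U A|.
Proof.
move=> /is_matchingP[M1 M2] sU AU.
pose f p := if p.1 \in connecting U A then p.1 else p.2 : V.
set S := [set p in M | _].
have fE p : p \in S -> f p \in connecting U A :\: both_sides.
  rewrite inE => /andP[/M1[p1 p2 _] rp]; rewrite in_setD.
  move: p1 p2; rewrite /f !(in_setD, in_setI) => /andP[/negbTE n1 y1] /andP[/negbTE n2 y2].
  by move: rp; rewrite /ready; case: ifP => h; rewrite ?h ?n1 ?n2 ?andbF //= => ->.
have finj : {in S &, injective f}.
  move=> p q pS qS; move: (pS) (qS); rewrite !inE => /andP[pM _] /andP[qM _].
  have [p1 p2 _] := M1 p pM; have [q1 q2 _] := M1 q qM; move: p1 p2 q1 q2.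
  rewrite /f !in_setD => /andP[_ p1] /andP[p2 _] /andP[_ q1] /andP[q2 _].
  case: ifP => _; case: ifP => _ pq.
  - by apply: M2 => //; left.
  - by move: q2; rewrite -pq p1.
  - by move: p2; rewrite pq q1.
  - by apply: M2 => //; right.
rewrite -(card_in_imset finj).
have sf : f @: S \subset connecting U A :\: both_sides.
  by apply/subsetP => _ /imsetP[p pS ->]; apply: fE.
have := subset_leq_card sf; rewrite cardsD.
have -> : connecting U A :&: both_sides = both_sides.
  by apply/setIidPr; apply: both_sides_connecting.
have := subset_leq_card (both_sides_connecting sU AU).
unfold reverse_coercion in *; lia.
Qed.

Definition layer (l : nat) (pi : {set {set V}}) : {set {set V}} :=
  [set U : {set V} | [&& U0 \subset U, #|U| == l & trace U == pi]].

(** Adding [u] injects the sets of the layer for which the pair is not ready into the ready sets of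
    the next layer. *)
Lemma layer_switch l pi p : A \in pi -> p.1 \in near_side -> p.2 \in far_side ->
  e p.1 p.2 ->
  #|layer l pi| <= #|[set U : {set V} in layer l pi | ready U p]|
                   + #|[set U : {set V} in layer l.+1 pi | ready U p]|.
Proof.
case: p => u w /= Api uP wQ uw.
have -> : #|layer l pi| = #|[set U : {set V} in layer l pi | ready U (u, w)]|
                 + #|[set U : {set V} in layer l pi | ~~ ready U (u, w)]|.
  rewrite -(cardsID [set U | ready U (u, w)] (layer l pi)).
  by congr (_ + _); apply: eq_card => U; rewrite !inE // andbC.
rewrite leq_add2l; set S := [set U in _ | ~~ _].
have SE U : U \in S -> [/\ u \notin U & u |: U \in [set U : {set V} in layer l.+1 pi | ready U (u, w)]].
  rewrite inE => /andP[]; rewrite inE => /and3P[sU /eqP cU /eqP tU] nr.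
  have AU : A \in trace U by rewrite tU.
  have [uU tE rE] := ready_or_switch sU AU uP wQ uw nr.
  split=> //; rewrite inE rE andbT inE tE tU eqxx andbT.
  by rewrite cardsU1 uU cU eqxx andbT (subset_trans sU) // subsetU1.
have inj : {in S &, injective (setU [set u])}.
  move=> U1 U2 /SE[u1 _] /SE[u2 _] h; rewrite -(setU1K u1) -(setU1K u2).
  by rewrite h.
rewrite -(card_in_imset inj); apply/subset_leq_card/subsetP => _ /imsetP[U US ->].
by have [] := SE _ US.
Qed.

End FixedClass.

(** A member of the layer shows that [A] and [U0 :\: A] are nonadjacent, which provides the
    connectors. Vertices of [both_sides] connect for every set of the layer; pairs of [M] are
    handled by [layer_switch], and the factor 2 is the one in front of [#|M|]. *)
Lemma class_switch l pi A : A \in pi -> 1 < #|pi| ->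
  K * #|layer l pi| <=
  2 * (\sum_(U in layer l pi) #|connecting U A|
       + \sum_(U in layer l.+1 pi) #|connecting U A|).
Proof.
move=> Api pi1; have [->|[U]] := set_0Vmem (layer l pi); first by rewrite cards0 muln0.
rewrite inE => /and3P[sU _ /eqP tU].
have AU : A \in trace U by rewrite tU.
have B0 : U0 :\: A != set0.
  have [B [C [Bpi Cpi BC]]] := card_gt1P pi1.
  have [D Dpi DA] : exists2 D, D \in pi & D != A.
    by have [<-|] := eqVneq B A; [exists C; rewrite // eq_sym|exists B].
  rewrite -tU in Dpi; case/imsetP: Dpi => b bU0 DE; apply/set0Pn; exists b.
  rewrite in_setD bU0 andbT; apply: contra DA => bA.
  by rewrite DE (component_trace e_sym AU bA).
have nAB : nonadjacent e A (U0 :\: A).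
  apply/nonadjacentP => a b aA bB; apply: contra (componentD U bB) => ab.
  have aU : a \in U by rewrite (subsetP sU) // (subsetP (trace_sub AU)).
  have bU : b \in U by move: bB; rewrite in_setD => /andP[_ /(subsetP sU)].
  by rewrite -(component_edge e_sym U0 aU bU ab) (component_trace e_sym AU aA).
have [M mM KM] := exists_large_matching (trace_sub AU) (trace_neq0 AU) B0 nAB.
have [M1 _] := is_matchingP _ _ mM.
have hM : #|M| * #|layer l pi| <=
   \sum_(U in layer l pi) #|[set p in M | ready A U p]|
   + \sum_(U in layer l.+1 pi) #|[set p in M | ready A U p]|.
  have ex l' : \sum_(U in layer l' pi) #|[set p in M | ready A U p]|
     = \sum_(p in M) #|[set U : {set V} in layer l' pi | ready A U p]|.
    under eq_bigr do rewrite -sum1_card.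
    under [RHS]eq_bigr do rewrite -sum1_card.
    rewrite (exchange_big_dep (mem M)) /=; last by move=> U' p _; rewrite inE => /andP[].
    by apply: eq_bigr => p pM; apply: eq_bigl => U'; rewrite !inE pM.
  rewrite !ex -big_split /= -sum1_card big_distrl /=.
  apply: leq_sum => p pM; rewrite mul1n; have [p1 p2 p12] := M1 p pM.
  exact: (@layer_switch A).
have hC l' : #|both_sides A| * #|layer l' pi| +
   \sum_(U in layer l' pi) #|[set p in M | ready A U p]| <=
   \sum_(U in layer l' pi) #|connecting U A|.
  rewrite mulnC -sum_nat_const -big_split /=; apply: leq_sum => U'.
  rewrite inE => /and3P[sU' _ /eqP tU']; apply: card_ready => //.
  by rewrite tU'.
have h1 := hC l; have h2 := hC l.+1.
have := leq_mul KM (leqnn #|layer l pi|); move: hM h1 h2.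
rewrite mulnDl -!mulnA; set x := #|layer l pi|.
nia.
Qed.

End Switching.

(** * Recursion for the number of surplus pieces *)

Lemma card_supersets (V : finType) (U0 : {set V}) l :
  #|[set U : {set V} | (U0 \subset U) && (#|U| == #|U0| + l)]| = 'C(#|V| - #|U0|, l).
Proof.
have -> : #|V| - #|U0| = #|~: U0| by rewrite -(cardsC U0) addKn.
rewrite -cards_draws.
have -> : #|[set U : {set V} | U \subset ~: U0 & #|U| == l]| =
  #|[set U0 :|: S | S in [set U : {set V} | U \subset ~: U0 & #|U| == l]]|.
  rewrite card_in_imset // => S S'; rewrite !inE => /andP[sS _] /andP[sS' _] h.
  have E (X : {set V}) : X \subset ~: U0 -> (U0 :|: X) :\: U0 = X.
    by move=> sX; rewrite setDUl setDv set0U; apply/setDidPl; rewrite disjoints_subset.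
  by rewrite -(E _ sS) -(E _ sS') h.
apply: eq_card => U.
apply/idP/imsetP => [|[S]]; rewrite inE => /andP[].
  move=> sU /eqP cU; exists (U :\: U0); last by rewrite setDE setUIr setUCr setIT; apply/esym/setUidPr.
  rewrite inE setDE subsetIr /= -setDE cardsD (setIidPr sU) cU addKn eqxx //.
move=> sS /eqP cS ->; rewrite inE subsetUl cardsU cS.
suff -> : U0 :&: S = set0 by rewrite cards0 subn0 eqxx.
by apply/eqP; rewrite setI_eq0 disjoint_sym disjoints_subset.
Qed.

Section Recursion.
Variables (V : finType) (e : rel V).
Hypotheses (e_sym : symmetric e) (e_refl : reflexive e).
Implicit Types (U A B : {set V}) (pi : {set {set V}}).

Variable K : nat.
Hypothesis separatorP : forall A B,
  A != set0 -> B != set0 -> nonadjacent e A B -> K <= #|~: (A :|: B)|.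

Variable U0 : {set V}.
Hypothesis dom : dominating e U0.

Local Notation trace := (trace e U0).
Local Notation connecting := (connecting e U0).
Local Notation adjacent_classes := (adjacent_classes e U0).
Local Notation layer := (layer e U0).

Definition supersets l : {set {set V}} :=
  [set U : {set V} | (U0 \subset U) && (#|U| == #|U0| + l)].

Definition excess U := #|trace U| - 1.
(** Divided by the number of supersets, this is the expected number of surplus pieces after [l]
    random additions to [U0]. *)
Definition total_excess l := \sum_(U in supersets l) excess U.
Definition total_gain l :=
  \sum_(U in supersets l) \sum_(v in ~: U) (#|adjacent_classes U v| - 1).

Lemma sum_layer l (F : {set V} -> nat) (P : pred {set {set V}}) :
  \sum_(pi | P pi) \sum_(U in layer (#|U0| + l) pi) F U =
  \sum_(U in supersets l | P (trace U)) F U.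
Proof.
rewrite (partition_big trace P) /=; last by move=> U /andP[].
apply: eq_bigr => pi Ppi; apply: eq_bigl => U; rewrite !inE -!andbA.
by do 2 congr andb; case: eqP => [->|]; rewrite ?Ppi ?andbF.
Qed.

(** Sum [class_switch] over all classes of all partitions with at least two classes. The constant is
    the 2 of [class_switch] times the 2 of [sum_connecting]. *)
Lemma total_excess_switch l :
  K * total_excess l <= 4 * (total_gain l + total_gain l.+1).
Proof.
have h1 : K * total_excess l <=
  \sum_(pi : {set {set V}} | 1 < #|pi|) \sum_(A in pi) K * #|layer (#|U0| + l) pi|.
  rewrite big_distrr /=.
  have := sum_layer l (fun U => K * #|trace U|) [pred pi : {set {set V}} | 1 < #|pi|].
  rewrite /= => E; apply: (@leq_trans (\sum_(U in supersets l | 1 < #|trace U|) K * #|trace U|)).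
    rewrite [leqRHS]big_mkcondr /=; apply: leq_sum => U _.
    rewrite /excess; case: ifP; last by move: #|trace U| => [|[|x]] //; rewrite muln0.
    by move=> _; rewrite leq_mul2l leq_subr orbT.
  rewrite -E; apply: leq_sum => pi _; rewrite sum_nat_const mulnCA mulnA mulnC.
  rewrite -sum_nat_const; apply: leq_sum => U.
  by rewrite inE => /and3P[_ _ /eqP ->].
have h2 l' : \sum_(pi : {set {set V}} | 1 < #|pi|) \sum_(A in pi)
     \sum_(U in layer (#|U0| + l') pi) #|connecting U A| <= 2 * total_gain l'.
  have E : \sum_(pi : {set {set V}} | 1 < #|pi|) \sum_(A in pi)
     \sum_(U in layer (#|U0| + l') pi) #|connecting U A| =
     \sum_(U in supersets l' | 1 < #|trace U|) \sum_(A in trace U) #|connecting U A|.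
    rewrite -(sum_layer l' (fun U => \sum_(A in trace U) #|connecting U A|)
      [pred pi : {set {set V}} | 1 < #|pi|]) /=.
    apply: eq_bigr => pi _; rewrite exchange_big /=; apply: eq_bigr => U.
    by rewrite inE => /and3P[_ _ /eqP ->].
  rewrite E big_distrr /= big_mkcondr /=; apply: leq_sum => U; rewrite inE => /andP[sU _].
  by case: ifP => // _; apply: sum_connecting.
apply: (leq_trans h1); apply: (@leq_trans (2 * (2 * total_gain l + 2 * total_gain l.+1))); last by lia.
apply: leq_trans (leq_mul (leqnn 2) (leq_add (h2 l) (h2 l.+1))).
rewrite -big_split big_distrr /=; apply: leq_sum => pi pi1.
rewrite -big_split big_distrr /=; apply: leq_sum => A Api.
by rewrite addnS; apply: class_switch.
Qed.

Lemma excessU1 U v : U0 \subset U ->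
  (#|adjacent_classes U v| - 1) + excess (v |: U) <= excess U.
Proof.
move=> sU; have h1 := card_traceU1 e_sym dom sU v.
have h2 := subset_leq_card (adjacent_classes_sub e_sym dom sU v).
have h3 := adjacent_classes_gt0 dom sU v.
rewrite /excess; move: h1 h2 h3; unfold reverse_coercion.
set a := #|trace (v |: U)|; set b := #|trace U|; set c := #|adjacent_classes U v|.
lia.
Qed.

(** Each superset at level [l.+1] arises from exactly [l.+1] pairs of a superset [U] at level [l]
    and a vertex outside [U]; sum [excessU1] over these pairs. *)
Lemma total_gain_le l :
  total_gain l + l.+1 * total_excess l.+1 <= (#|V| - #|U0| - l) * total_excess l.
Proof.
have -> : l.+1 * total_excess l.+1 =
   \sum_(U in supersets l) \sum_(v in ~: U) excess (v |: U).
  rewrite /total_excess big_distrr /=.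
  transitivity (\sum_(U in supersets l.+1) \sum_(v in U :\: U0) excess U).
    apply: eq_bigr => U; rewrite inE => /andP[sU /eqP cU].
    by rewrite sum_nat_const cardsD (setIidPr sU) cU addKn.
  rewrite (exchange_big_dep predT) //= [RHS](exchange_big_dep predT) //=.
  apply: eq_bigr => v _.
  rewrite (reindex_onto (fun U => v |: U) (fun U => U :\ v)) /=; last first.
    by move=> U /andP[_]; rewrite in_setD => /andP[_ vU]; rewrite setD1K.
  apply: eq_bigl => U; rewrite !inE eqxx /=.
  have [vU|vU] := boolP (v \in U).
    rewrite andbF; apply/negP => /andP[_ /eqP]; rewrite setUC setDUl setDv setU0 => E.
    by move: vU; rewrite -E !inE eqxx.
  rewrite setU1K // eqxx andbT cardsU1 vU addnS eqSS.
  have [vU0|vU0] := boolP (v \in U0).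
    rewrite andbF andbT; apply/esym/negbTE; apply: contra vU => /andP[/subsetP sU _].
    exact: sU.
  rewrite !andbT; congr (_ && _); apply/idP/idP; last first.
    by move=> sU; apply: subset_trans sU (subsetU1 _ _).
  move/subsetP => sU; apply/subsetP => x xU0; have := sU x xU0.
  by rewrite !inE => /orP[/eqP xv|//]; move: vU0; rewrite -xv xU0.
rewrite /total_gain /total_excess -big_split big_distrr /=; apply: leq_sum => U.
rewrite inE => /andP[sU /eqP cU]; rewrite -big_split /=.
have -> : #|V| - #|U0| - l = #|~: U| by rewrite -subnDA -cU -(cardsC U) addKn.
rewrite -sum_nat_const; apply: leq_sum => v _.
exact: excessU1.
Qed.

Lemma total_excess_le l : total_excess l <= #|V| * 'C(#|V| - #|U0|, l).
Proof.
rewrite mulnC -card_supersets -sum_nat_const; apply: leq_sum => U _.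
rewrite /excess; apply: leq_trans (leq_subr _ _) _.
exact: leq_trans (leq_imset_card _ _) (max_card _).
Qed.

End Recursion.

(** * Geometric decay from the two recursive inequalities *)

Section Decay.
Variable R : realFieldType.
Local Open Scope ring_scope.

(** In terms of the means [g j], the second inequality bounds [D j] by a multiple of [g j - g j.+1].
    Inserted in the first, it bounds [g j] by a multiple of the drop over two levels. *)
Lemma double_step_decay (n N K q : nat) (G D : nat -> nat) (c : R) :
  (forall j, K * G j <= 4 * (D j + D j.+1))%N ->
  (forall j, D j + j.+1 * G j.+1 <= (n - j) * G j)%N ->
  (0 < q)%N -> (q <= N)%N -> (n <= N)%N -> 0 <= c ->
  1 - (q * K)%:R / (4 * N ^ 2)%:R <= c ->
  forall i, (q + i.*2 <= n)%N ->
  (G (q + i.*2)%N)%:R / 'C(n, q + i.*2)%:R <= c ^+ i * ((G q)%:R / 'C(n, q)%:R) :> R.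
Proof.
move=> HK HD q0 qN nN c0 hc.
pose g j : R := (G j)%:R / 'C(n, j)%:R.
have Cp j : (j <= n)%N -> 0 < 'C(n, j)%:R :> R by move=> jn; rewrite ltr0n bin_gt0.
have g0 j : 0 <= g j by rewrite divr_ge0.
have Dg j : (j < n)%N -> (D j)%:R <= (n - j)%:R * 'C(n, j)%:R * (g j - g j.+1) :> R.
  move=> jn; have := HD j; rewrite -(ler_nat R) natrD !natrM => h.
  have E : j.+1%:R * 'C(n, j.+1)%:R = (n - j)%:R * 'C(n, j)%:R :> R.
    by rewrite -!natrM mul_bin_left.
  have -> : (n - j)%:R * 'C(n, j)%:R * (g j - g j.+1)
     = (n - j)%:R * (G j)%:R - j.+1%:R * (G j.+1)%:R.
    rewrite mulrBr -{2}E /g; have := Cp _ jn; have := Cp _ (ltnW jn) => /lt0r_neq0 a /lt0r_neq0 b.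
    by field; rewrite a b.
  lra.
have gdec j : (j < n)%N -> g j.+1 <= g j.
  move=> jn; rewrite -subr_ge0.
  have h : 0 <= (n - j)%:R * 'C(n, j)%:R * (g j - g j.+1) by apply: le_trans (Dg j jn).
  have p : 0 < (n - j)%:R * 'C(n, j)%:R :> R.
    by rewrite mulr_gt0 ?Cp ?ltr0n ?subn_gt0 // ltnW.
  by rewrite pmulr_rge0 in h.
have N0 : 0 < N%:R :> R by rewrite ltr0n; apply: leq_trans qN.
have step j : (q <= j)%N -> (j.+2 <= n)%N -> g j.+2 <= c * g j.
  move=> qj jn.
  have h1 := Dg j (ltnW jn); have h2 := Dg j.+1 jn.
  have E : j.+1%:R * 'C(n, j.+1)%:R = (n - j)%:R * 'C(n, j)%:R :> R.
    by rewrite -!natrM mul_bin_left.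
  have d1 := gdec j (ltnW jn); have d2 := gdec j.+1 jn.
  have h3 : K%:R * (G j)%:R <= 4 * ((D j)%:R + (D j.+1)%:R) :> R.
    by have := HK j; rewrite -(ler_nat R) !natrM natrD.
  have Cj := Cp j (ltnW (ltnW jn)).
  have Gj : (G j)%:R = 'C(n, j)%:R * g j by rewrite /g mulrC divfK ?lt0r_neq0.
  (* Going up one level multiplies the number of sets by [(n - j) / j.+1]. Clearing this denominator
     leaves the factor [j.+1], which is at least [q] from level [q] on. *)
  have h4 : j.+1%:R * (K%:R * g j) <=
    4 * (n - j)%:R * (j.+1%:R * (g j - g j.+1) + (n - j.+1)%:R * (g j.+1 - g j.+2)).
    rewrite -(ler_pM2l Cj).
    apply: (@le_trans _ _ (j.+1%:R * (4 * ((n - j)%:R * 'C(n, j)%:R * (g j - g j.+1) +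
        (n - j.+1)%:R * 'C(n, j.+1)%:R * (g j.+1 - g j.+2))))).
      have -> : 'C(n, j)%:R * (j.+1%:R * (K%:R * g j)) = j.+1%:R * (K%:R * (G j)%:R).
        by rewrite Gj; ring.
      by rewrite ler_wpM2l //; apply: le_trans h3 _; rewrite ler_wpM2l // lerD.
    rewrite le_eqVlt; apply/orP; left; apply/eqP.
    transitivity (4 * (n - j)%:R * 'C(n, j)%:R * j.+1%:R * (g j - g j.+1)
      + 4 * (n - j.+1)%:R * (j.+1%:R * 'C(n, j.+1)%:R) * (g j.+1 - g j.+2)); first by ring.
    by rewrite E; ring.
  have qj' : q%:R <= j.+1%:R :> R by rewrite ler_nat leqW.
  have jN : j.+1%:R <= N%:R :> R by rewrite ler_nat; apply: leq_trans nN; apply: ltnW.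
  have njN : (n - j)%:R <= N%:R :> R by rewrite ler_nat; apply: leq_trans nN; apply: leq_subr.
  have njN1 : (n - j.+1)%:R <= N%:R :> R by rewrite ler_nat; apply: leq_trans nN; apply: leq_subr.
  have h5 : q%:R * (K%:R * g j) <= 4 * N%:R * (N%:R * (g j - g j.+1) + N%:R * (g j.+1 - g j.+2)).
    apply: (@le_trans _ _ (j.+1%:R * (K%:R * g j))).
      by rewrite ler_wpM2r // mulr_ge0.
    apply: (le_trans h4); apply: ler_pM.
    - by rewrite mulr_ge0.
    - by rewrite addr_ge0 // mulr_ge0 // subr_ge0.
    - by rewrite ler_wpM2l.
    - by apply: lerD; rewrite ler_wpM2r // subr_ge0.
  apply: (@le_trans _ _ ((1 - (q * K)%:R / (4 * N ^ 2)%:R) * g j)); last first.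
    by rewrite ler_wpM2r.
  rewrite mulrBl mul1r lerBrDr -lerBrDl mulrAC ler_pdivrMr; last first.
    by rewrite natrM natrX mulr_gt0 // exprn_gt0.
  have -> : (4 * N ^ 2)%:R = 4 * N%:R ^+ 2 :> R by rewrite natrM natrX.
  rewrite natrM -mulrA; apply: (le_trans h5).
  rewrite le_eqVlt; apply/orP; left; apply/eqP; ring.
elim=> [|i IH] hi; first by rewrite addn0 expr0 mul1r.
have E : (q + i.+1.*2 = (q + i.*2).+2)%N by lia.
rewrite E in hi *.
apply: le_trans (step _ _ hi) _; first by rewrite leq_addr.
by rewrite exprS -mulrA ler_wpM2l // IH //; lia.
Qed.

End Decay.

(** * Random vertex subsets *)

(** A random [l]-subset of [N] points misses [d] given points with probability at most
    [(1 - l / N) ^ d]: the [d] points are missed one after the other, and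
    [(N - d - l) / (N - d) <= (N - l) / N]. *)
Lemma bin_sub_le N d l : d <= N -> 'C(N - d, l) * N ^ d <= (N - l) ^ d * 'C(N, l).
Proof.
elim: d => [|d IH] dN; first by rewrite !expn0 subn0 muln1 mul1n.
have {}IH := IH (ltnW dN).
have p : 0 < N - d by rewrite subn_gt0.
have E : (N - d) * 'C(N - d.+1, l) = (N - d - l) * 'C(N - d, l).
  by rewrite subnS mul_bin_down.
have le : N * (N - d - l) <= (N - d) * (N - l) by nia.
rewrite -(leq_pmul2l p) mulnA E expnS.
apply: (@leq_trans ((N - d) * (N - l) * ('C(N - d, l) * N ^ d))).
  have := leq_mul le (leqnn ('C(N - d, l) * N ^ d)); lia.
by rewrite expnS -!mulnA !leq_mul2l IH !orbT.
Qed.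

Lemma mul_bin_nested N a b : a + b <= N ->
  'C(N, a) * 'C(N - a, b) = 'C(N, a + b) * 'C(a + b, a).
Proof.
move=> abN.
have h1 := bin_fact (leq_trans (leq_addr b a) abN).
have bNa : b <= N - a by lia.
have h2 := bin_fact bNa.
have h3 := bin_fact abN.
have h4 := bin_fact (leq_addr b a); rewrite addKn in h4.
have E : N - a - b = N - (a + b) by lia.
rewrite E in h2.
have p : 0 < a`! * b`! * (N - (a + b))`! by rewrite !muln_gt0 !fact_gt0.
apply/eqP; rewrite -(eqn_pmul2r p); apply/eqP.
transitivity (N`!).
  by rewrite -h1 -h2; ring.
by rewrite -h3 -h4; ring.
Qed.

Lemma card_bigcup_le (I T : finType) (P : pred I) (F : I -> {set T}) :
  #|\bigcup_(i | P i) F i| <= \sum_(i | P i) #|F i|.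
Proof.
elim/big_rec2: _ => [|i n A _ IH]; first by rewrite cards0.
by apply: leq_trans (leq_card_setU _ _).1 _; rewrite leq_add2l.
Qed.

Section Sampling.
Variables (V : finType) (e : rel V).
Hypotheses (e_sym : symmetric e) (e_refl : reflexive e).
Implicit Types (U A B : {set V}).

Variable K : nat.
Hypothesis KV : K <= #|V|.
Hypothesis separatorP : forall A B,
  A != set0 -> B != set0 -> nonadjacent e A B -> K <= #|~: (A :|: B)|.

(** Neither [A] nor [B] is required to meet [U], so a connected [U] may qualify; domination excludes
    that case below. *)
Definition split_by_cut U : bool :=
  [exists A : {set V}, exists B : {set V},
    [&& A != set0, B != set0, nonadjacent e A B & U \subset A :|: B]].

(** The closed neighbourhood of [v] without [v] separates [v] from the other vertices, if there are
    any; otherwise [KV] applies. *)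
Lemma neighbourhood_ge v : K <= #|[set u | e v u]|.
Proof.
have [E|] := eqVneq (~: [set u | e v u]) set0.
  by rewrite -[[set u | _]]setCK E setC0 cardsT.
move=> B0; apply: leq_trans (separatorP (A := [set v]) _ B0 _) _.
- by apply/set0Pn; exists v; rewrite inE.
- by apply/nonadjacentP => x y /set1P ->; rewrite !inE.
- by apply: subset_leq_card; apply/subsetP => u; rewrite !inE negb_or negbK => /andP[].
Qed.

Lemma card_nondominating l :
  #|[set D : {set V} | (#|D| == l) && ~~ dominating e D]| <= #|V| * 'C(#|V| - K, l).
Proof.
have s : [set D : {set V} | (#|D| == l) && ~~ dominating e D] \subset
   \bigcup_(v : V) [set D : {set V} | D \subset ~: [set u | e v u] & #|D| == l].
  apply/subsetP => D; rewrite inE => /andP[cD]; rewrite negb_forall => /existsP[v].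
  rewrite negb_exists => /forallP h; apply/bigcupP; exists v => //.
  rewrite inE cD andbT; apply/subsetP => u uD; rewrite !inE.
  by have := h u; rewrite uD.
apply: leq_trans (subset_leq_card s) _.
apply: leq_trans (card_bigcup_le _ _) _.
rewrite -sum_nat_const; apply: leq_sum => v _.
rewrite cards_draws; apply: leq_bin2l.
have := cardsC [set u | e v u]; have := neighbourhood_ge v; lia.
Qed.

(** Domination gives vertices of [U0] in both [A] and [B]. No path inside [U] joins them, so there
    are at least two classes. *)
Lemma split_by_cut_excess U0 U : dominating e U0 -> U0 \subset U -> split_by_cut U ->
  0 < excess e U0 U.
Proof.
move=> dom sU /existsP[A /existsP[B /and4P[/set0Pn[a aA] /set0Pn[b bB] /nonadjacentP nAB /subsetP sAB]]].
have [u uU0 au] := dominatingE dom a; have [w wU0 bw] := dominatingE dom b.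
have uA : u \in A.
  have := sAB u (subsetP sU u uU0); rewrite inE => /orP[//|uB].
  by move: (nAB a u aA uB); rewrite au.
have wB : w \in B.
  have := sAB w (subsetP sU w wU0); rewrite inE => /orP[wA|//].
  by move: (nAB w b wA bB); rewrite e_sym bw.
have nAB' x : x \in A -> x \in B -> False.
  by move=> xA xB; have := nAB x x xA xB; rewrite e_refl.
rewrite /excess subn_gt0; apply/card_gt1P; exists (component e U0 U u), (component e U0 U w).
split; [exact: imset_f|exact: imset_f|].
apply/eqP => E; have := mem_component e U wU0; rewrite -E inE => /andP[_].
have inv x y : induced e U x y -> (x \in A) = (y \in A).
  move=> /and3P[/sAB xU /sAB yU xy]; move: xU yU; rewrite !inE.
  have [xA|xA] := boolP (x \in A); have [yA|yA] := boolP (y \in A) => //= h1 h2.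
    by move: (nAB x y xA h2); rewrite xy.
  by move: (nAB y x yA h1); rewrite e_sym xy.
move/(connect_invariant inv); rewrite uA => /esym wA.
exact: nAB' wA wB.
Qed.

Local Open Scope ring_scope.
Variable R : realFieldType.

(* The [l0 + 3 q] sampled vertices are exposed in three batches: [l0] to
   dominate, [q] to make half-open connections likely, and [2 q] to let the
   number of components decay. *)
Lemma card_split_by_cut (l0 q : nat) (c : R) :
  (0 < q)%N -> (l0 + 3 * q <= #|V|)%N -> 0 <= c ->
  1 - (q * K)%:R / (4 * #|V| ^ 2)%:R <= c ->
  #|[set U : {set V} | (#|U| == l0 + 3 * q)%N && split_by_cut U]|%:R <=
  #|V|%:R * ((1 - l0%:R / #|V|%:R) ^+ K + c ^+ q) * 'C(#|V|, l0 + 3 * q)%:R :> R.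
Proof.
move=> q0 TN c0 hc; set N := #|V|; set T := (l0 + 3 * q)%N.
set S := [set U | _].
have N0 : 0 < N%:R :> R by rewrite ltr0n /N; lia.
(* Count the pairs [U0 \subset U] with [#|U0| = l0] and [U] in [S]; this amounts to exposing the
   first batch of a random [U]. *)
have dbl : ('C(T, l0) * #|S| = \sum_(U0 : {set V} | #|U0| == l0) #|[set U in S | U0 \subset U]|)%N.
  rewrite mulnC -sum_nat_const.
  under [RHS]eq_bigr do rewrite -sum1_card.
  rewrite (exchange_big_dep (mem S)) /=; last by move=> U0 U _; rewrite inE => /andP[].
  apply: eq_bigr => U US; have cU : #|U| = T by move: US; rewrite inE => /andP[/eqP].
  rewrite -cU -cards_draws -sum1_card; apply: eq_bigl => U0.
  by rewrite !inE; move: US; rewrite inE => ->; rewrite andbC.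
have nd (U0 : {set V}) : #|U0| == l0 -> (#|[set U in S | U0 \subset U]| <= 'C(N - l0, 3 * q))%N.
  move=> /eqP cU0; rewrite -cU0 -card_supersets; apply/subset_leq_card/subsetP => U.
  by rewrite !inE cU0 => /andP[/andP[-> _] ->].
have dm (U0 : {set V}) : #|U0| == l0 -> dominating e U0 ->
   #|[set U in S | U0 \subset U]|%:R <= c ^+ q * N%:R * 'C(N - l0, 3 * q)%:R :> R.
  move=> /eqP cU0 dom.
  apply: (@le_trans _ _ (total_excess e U0 (3 * q))%:R).
    rewrite ler_nat /total_excess -sum1_card.
    rewrite [leqLHS]big_mkcond [leqRHS]big_mkcond /=; apply: leq_sum => U _.
    case: ifP => //; rewrite !inE => /andP[/andP[/eqP cU bU] sU].
    by rewrite sU cU cU0 eqxx /=; apply: split_by_cut_excess.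
  have h := @double_step_decay R (N - l0) N K q (total_excess e U0) (total_gain e U0) c
    (total_excess_switch e_sym e_refl separatorP dom).
  have h' := h (fun j => _) q0 _ _ c0 hc q _.
  (* From level [q], where the mean excess is at most [N], the [q] double steps lead to level
     [3 * q]. *)
  have {}h' : (total_excess e U0 (q + q.*2))%:R / 'C(N - l0, q + q.*2)%:R <=
     c ^+ q * ((total_excess e U0 q)%:R / 'C(N - l0, q)%:R) :> R.
    apply: h' => [j|||]; last by rewrite /N; lia.
    - by have := total_gain_le e_sym dom j; rewrite cU0.
    - by rewrite /N; lia.
    - exact: leq_subr.
  have E : (q + q.*2 = 3 * q)%N by lia.
  rewrite E in h'; rewrite ler_pdivrMr in h'; last by rewrite ltr0n bin_gt0 /N; lia.
  apply: (le_trans h'); rewrite ler_wpM2r // ler_wpM2l ?exprn_ge0 //.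
  rewrite ler_pdivrMr; last by rewrite ltr0n bin_gt0 /N; lia.
  by rewrite -natrM ler_nat -cU0; apply: total_excess_le.
have Cp : 0 < 'C(T, l0)%:R :> R by rewrite ltr0n bin_gt0 /T; lia.
rewrite -(ler_pM2l Cp) -natrM dbl.
rewrite (bigID (fun U0 => dominating e U0)) /= natrD.
have b1 : (\sum_(U0 : {set V} | (#|U0| == l0) && dominating e U0) #|[set U in S | U0 \subset U]|)%:R
   <= c ^+ q * N%:R * 'C(N - l0, 3 * q)%:R * 'C(N, l0)%:R :> R.
  rewrite natr_sum.
  apply: (@le_trans _ _ (\sum_(U0 : {set V} | (#|U0| == l0) && dominating e U0)
     (c ^+ q * N%:R * 'C(N - l0, 3 * q)%:R))).
    by apply: ler_sum => U0 /andP[]; apply: dm.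
  rewrite sumr_const -[leLHS]mulr_natr ler_wpM2l ?mulr_ge0 ?exprn_ge0 //.
  rewrite ler_nat -card_draws; apply: subset_leq_card; apply/subsetP => U0.
  by rewrite !inE => /andP[].
have b2 : (\sum_(U0 : {set V} | (#|U0| == l0) && ~~ dominating e U0) #|[set U in S | U0 \subset U]|)%:R
   <= N%:R * (1 - l0%:R / N%:R) ^+ K * 'C(N, l0)%:R * 'C(N - l0, 3 * q)%:R :> R.
  apply: (@le_trans _ _ (N * 'C(N - K, l0) * 'C(N - l0, 3 * q))%:R).
    rewrite ler_nat; apply: leq_trans (leq_mul (card_nondominating l0) (leqnn _)).
    rewrite -sum_nat_const [leqRHS](eq_bigl (fun U0 : {set V} => (#|U0| == l0) && ~~ dominating e U0));
      last by move=> U0; rewrite inE.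
    by apply: leq_sum => U0 /andP[]; move/nd.
  rewrite !natrM ler_wpM2r // -mulrA ler_wpM2l //.
  have -> : 1 - l0%:R / N%:R = (N - l0)%:R / N%:R :> R.
    by rewrite natrB ?mulrBl ?divff ?lt0r_neq0 // /N; lia.
  rewrite expr_div_n mulrAC ler_pdivlMr ?exprn_gt0 //.
  by rewrite -!natrX -!natrM ler_nat; apply: bin_sub_le.
have E : 'C(N, l0)%:R * 'C(N - l0, 3 * q)%:R = 'C(N, T)%:R * 'C(T, l0)%:R :> R.
  by rewrite -!natrM mul_bin_nested.
apply: le_trans (lerD b1 b2) _.
rewrite le_eqVlt; apply/orP; left; apply/eqP.
transitivity (N%:R * ((1 - l0%:R / N%:R) ^+ K + c ^+ q) * ('C(N, l0)%:R * 'C(N - l0, 3 * q)%:R)); first by ring.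
by rewrite E; ring.
Qed.

End Sampling.

(** * Random perfect matchings *)

Lemma exists_perm_mem (T : finType) (A B : {set T}) :
  #|A| = #|B| -> exists s : {perm T}, forall x, (s x \in B) = (x \in A).
Proof.
move=> cAB.
(* List the set first and its complement second; the permutation matches equal positions in the
   lists for [A] and [B]. *)
pose sq (X : {set T}) := enum X ++ enum (~: X).
have sqU X : uniq (sq X).
  rewrite cat_uniq !enum_uniq andbT /=; apply/hasPn => x.
  by rewrite !mem_enum inE.
have sqM X x : x \in sq X by rewrite mem_cat !mem_enum inE orbN.
have sqS X : size (sq X) = #|T| by rewrite size_cat -!cardE cardsC.
pose f x := nth x (sq B) (index x (sq A)).
have lt x : index x (sq A) < size (sq B) by rewrite sqS -(sqS A) index_mem.
have finj : injective f.
  move=> x y; rewrite /f (set_nth_default y) // => /eqP.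
  rewrite nth_uniq // => /eqP h.
  by rewrite -(nth_index x (sqM A x)) h nth_index.
exists (perm finj) => x; rewrite permE /f nth_cat /sq.
have -> : size (enum B) = size (enum A) by rewrite -!cardE.
rewrite index_cat mem_enum; have [xA|xA] := boolP (x \in A).
  have h : index x (enum A) < size (enum A) by rewrite index_mem mem_enum.
  rewrite h -mem_enum mem_nth //.
  by rewrite -(cardE B) -cAB cardE.
rewrite ltnNge leq_addr /= addKn.
have : nth x (enum (~: B)) (index x (enum (~: A))) \in enum (~: B).
  apply: mem_nth; rewrite -cardE cardsCs setCK -cAB -{2}(setCK A) -cardsCs cardE.
  by rewrite index_mem mem_enum inE xA.
by rewrite mem_enum inE => /negbTE.
Qed.

Section Survivors.
Variables (G1 G2 : sgraph) (s1 s2 : nat).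
Local Notation C1 := (copies G1 s1).
Local Notation C2 := (copies G2 s2).
Implicit Types (M : matching G1 G2 s1 s2) (W : {set G2}) (U : {set C1}).

Lemma perfect_matchingP M :
  reflect [/\ forall a, exists b, (a, b) \in M, forall b, exists a, (a, b) \in M,
    forall a b b', (a, b) \in M -> (a, b') \in M -> b = b' &
    forall a a' b, (a, b) \in M -> (a', b) \in M -> a = a']
    (perfect_matching M).
Proof.
apply: (iffP andP) => [[/forallP h1 /forallP h2]|[h1 h2 h3 h4]]; split.
- by move=> a; have /cards1P[b E] := h1 a; exists b; have := set11 b; rewrite -E inE.
- by move=> b; have /cards1P[a E] := h2 b; exists a; have := set11 a; rewrite -E inE.
- move=> a b b' ab ab'; have /cards1P[b0 E] := h1 a.
  have /set1P -> : b \in [set b0] by rewrite -E inE.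
  by have /set1P -> : b' \in [set b0] by rewrite -E inE.
- move=> a a' b ab ab'; have /cards1P[b0 E] := h2 b.
  have /set1P -> : a \in [set b0] by rewrite -E inE.
  by have /set1P -> : a' \in [set b0] by rewrite -E inE.
- apply/forallP => a; have [b ab] := h1 a; apply/cards1P; exists b.
  by apply/setP => b'; rewrite !inE; apply/idP/eqP => [ab'|->]; rewrite // (h3 _ _ _ ab ab').
- apply/forallP => b; have [a ab] := h2 b; apply/cards1P; exists a.
  by apply/setP => a'; rewrite !inE; apply/idP/eqP => [ab'|->]; rewrite // (h4 _ _ _ ab ab').
Qed.

Definition survivors M W : {set C1} :=
  [set a | [exists b : C2, ((a, b) \in M) && (b.1 \notin W)]].

Lemma card_copies (G : sgraph) s (A : {set G}) :
  #|[set a : copies G s | a.1 \in A]| = #|A| * s.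
Proof.
have -> : [set a : copies G s | a.1 \in A] = setX A [set: 'I_s].
  by apply/setP => -[x i]; rewrite !inE andbT.
by rewrite cardsX cardsT card_ord.
Qed.

Lemma card_survivors M W : perfect_matching M ->
  #|survivors M W| = (#|G2| - #|W|) * s2.
Proof.
move=> /perfect_matchingP[h1 h2 h3 h4].
pose P := [set p in M | p.2.1 \notin W].
have -> : survivors M W = fst @: P.
  apply/setP => a; rewrite inE; apply/existsP/imsetP => [[b abW]|[[a' b]]].
    by exists (a, b); rewrite // inE.
  by rewrite inE => /andP[abM bW] /= ->; exists b; rewrite abM.
rewrite card_in_imset; last first.
  move=> [a b] [a' b']; rewrite !inE => /andP[ab _] /andP[ab' _] /= aa'.
  by rewrite -aa' in ab' *; rewrite (h3 _ _ _ ab ab').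
have sinj : {in P &, injective snd}.
  move=> [a b] [a' b']; rewrite !inE => /andP[ab _] /andP[ab' _] /= bb'.
  by rewrite -bb' in ab' *; rewrite (h4 _ _ _ ab ab').
rewrite -(card_in_imset sinj).
have -> : snd @: P = [set b : C2 | b.1 \in ~: W].
  apply/setP => b; apply/imsetP/idP => [[[a b']]|].
    by rewrite !inE => /andP[_ bW] /= ->.
  rewrite !inE => bW; have [a ab] := h2 b; exists (a, b) => //.
  by rewrite inE ab.
by rewrite card_copies -(cardsC W) addKn.
Qed.

Definition permute_matching (s : {perm C1}) M : matching G1 G2 s1 s2 :=
  [set p | (s p.1, p.2) \in M].

Lemma perfect_permute s M : perfect_matching M -> perfect_matching (permute_matching s M).
Proof.
move=> /perfect_matchingP[h1 h2 h3 h4]; apply/perfect_matchingP; split.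
- by move=> a; have [b ab] := h1 (s a); exists b; rewrite inE.
- by move=> b; have [a ab] := h2 b; exists (s^-1 a)%g; rewrite inE /= permKV.
- by move=> a b b'; rewrite !inE; apply: h3.
- by move=> a a' b; rewrite !inE /= => /h4 h /h /perm_inj.
Qed.

Lemma survivors_permute s M W a :
  (a \in survivors (permute_matching s M) W) = (s a \in survivors M W).
Proof. by rewrite !inE; apply: eq_existsb => b; rewrite inE. Qed.

Lemma permute_matching_inj s : injective (permute_matching s).
Proof.
move=> M M' /setP h; apply/setP => -[a b].
by have := h ((s^-1)%g a, b); rewrite !inE /= permKV.
Qed.

(** Relabelling the copies of [G1] by a permutation taking one set onto the other acts injectively
    on perfect matchings, so all survivor sets of equal size are equally likely. *)
Lemma card_survivors_eq W U U' : #|U| = #|U'| ->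
  #|[set M | perfect_matching M & survivors M W == U]| =
  #|[set M | perfect_matching M & survivors M W == U']|.
Proof.
suff le (X Y : {set C1}) : #|X| = #|Y| ->
    #|[set M | perfect_matching M & survivors M W == Y]| <=
    #|[set M | perfect_matching M & survivors M W == X]|.
  by move=> h; apply/eqP; rewrite eqn_leq !le.
move=> /exists_perm_mem[s sE]; rewrite -(card_imset _ (@permute_matching_inj s)).
apply/subset_leq_card/subsetP => _ /imsetP[M + ->]; rewrite !inE.
case/andP => pM /eqP E; rewrite perfect_permute //=.
by apply/eqP/setP => a; rewrite survivors_permute E sE.
Qed.

(** The law of the survivor set, uniform on sets of its fixed size, in a form without division. *)
Lemma card_survivors_pred W (P : pred {set C1}) :
  (#|G2| - #|W|) * s2 <= #|C1| ->
  #|[set M | perfect_matching M & P (survivors M W)]| * 'C(#|C1|, (#|G2| - #|W|) * s2) =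
  #|[set M : matching G1 G2 s1 s2 | perfect_matching M]| *
    #|[set U : {set C1} | (#|U| == (#|G2| - #|W|) * s2) && P U]|.
Proof.
set T := (_ * s2)%N => TN.
have [U0 U0T] : exists U0 : {set C1}, #|U0| = T.
  have : 0 < #|[set U : {set C1} | #|U| == T]| by rewrite card_draws bin_gt0.
  by case/card_gt0P => U; rewrite inE => /eqP; exists U.
pose b := #|[set M | perfect_matching M & survivors M W == U0]|.
have E (Q : pred {set C1}) : #|[set M | perfect_matching M & Q (survivors M W)]| =
   #|[set U : {set C1} | (#|U| == T) && Q U]| * b.
  rewrite -sum1_card (partition_big (fun M => survivors M W)
      [pred U : {set C1} | (#|U| == T) && Q U]) /=; last first.
    by move=> M; rewrite inE => /andP[pM ->]; rewrite card_survivors // eqxx.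
  rewrite -sum_nat_const; apply: eq_big => [U|U /andP[/eqP cU QU]]; first by rewrite inE.
  rewrite /b (@card_survivors_eq W U0 U) ?U0T // -sum1_card; apply: eq_bigl => M.
  by rewrite !inE; case: eqP => [->|]; rewrite ?QU ?andbT ?andbF.
rewrite E.
have -> : #|[set M : matching G1 G2 s1 s2 | perfect_matching M]| = 'C(#|C1|, T) * b.
  have := E predT; rewrite /= => E'.
  rewrite -card_draws; transitivity #|[set M | perfect_matching M & predT (survivors M W)]|.
    by apply: eq_card => M; rewrite !inE andbT.
  by rewrite E'; congr (_ * b); apply: eq_card => U; rewrite !inE andbT.
lia.
Qed.

Lemma exists_perfect_matching : #|C1| = #|C2| ->
  0 < #|[set M : matching G1 G2 s1 s2 | perfect_matching M]|.
Proof.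
move=> cC; apply/card_gt0P.
exists [set p : C1 * C2 | enum_rank p.1 == enum_rank p.2 :> nat].
rewrite inE; apply/perfect_matchingP; split.
- move=> a; exists (enum_val (cast_ord cC (enum_rank a))).
  by rewrite inE /= enum_valK.
- move=> b; exists (enum_val (cast_ord (esym cC) (enum_rank b))).
  by rewrite inE /= enum_valK.
- move=> a b b'; rewrite !inE /= => /eqP -> /eqP h.
  by apply/enum_rank_inj/val_inj.
- move=> a a' b; rewrite !inE /= => /eqP h /eqP h'.
  by apply/enum_rank_inj/val_inj; rewrite /= h h'.
Qed.

(** * Node cuts, separators of the blow-up and supply cuts *)

Definition blowup (G : sgraph) s : rel (copies G s) :=
  [rel a b | (a.1 == b.1) || edge a.1 b.1].

Lemma blowup_sym (G : sgraph) s : symmetric (@blowup G s).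
Proof. by move=> a b; rewrite /blowup /= eq_sym edge_sym. Qed.

Lemma blowup_refl (G : sgraph) s : reflexive (@blowup G s).
Proof. by move=> a; rewrite /blowup /= eqxx. Qed.

Lemma edge_del_connect_sym (G : sgraph) (C : {set G}) : connect_sym (edge_del C).
Proof.
apply: sym_connect_sym => x y; rewrite /edge_del /= edge_sym.
by case: (x \in C); case: (y \in C).
Qed.

Lemma node_cut_of_sides (G : sgraph) (A B : {set G}) :
  A != set0 -> B != set0 ->
  (forall x y, x \in A -> y \in B -> (x != y) && ~~ edge x y) ->
  node_cut (~: (A :|: B)).
Proof.
move=> /set0Pn[x xA] /set0Pn[y yB] nAB.
set C := ~: _; have invC u v : edge_del C u v -> (u \in C) = (v \in C).
  by move=> /and3P[/negbTE -> /negbTE ->].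
have nC u : (u \notin C) = (u \in A) || (u \in B) by rewrite /C !inE negbK.
have AB u : u \in A -> u \in B -> False.
  by move=> uA uB; have := nAB u u uA uB; rewrite eqxx.
have invA u v : edge_del C u v -> (u \in A) = (v \in A).
  rewrite /edge_del /= !nC => /and3P[hu hv uv].
  have [uA|uA] := boolP (u \in A); have [vA|vA] := boolP (v \in A) => //.
    move: hv; rewrite (negbTE vA) /= => vB.
    by have := nAB u v uA vB; rewrite uv andbF.
  move: hu; rewrite (negbTE uA) /= => uB.
  by have := nAB v u vA uB; rewrite edge_sym uv andbF.
rewrite /node_cut; apply/orP; left; apply/card_gt1P.
have rC z : z \notin C -> fingraph.root (edge_del C) z \in predI (roots (edge_del C)) (mem (~: C)).
  move=> zC; apply/andP; split; first exact/roots_root/edge_del_connect_sym.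
  by rewrite /= in_setC -(connect_invariant invC (connect_root _ z)) zC.
exists (fingraph.root (edge_del C) x), (fingraph.root (edge_del C) y); split.
- by apply: rC; rewrite nC xA.
- by apply: rC; rewrite nC yB orbT.
- rewrite root_connect; last exact: edge_del_connect_sym.
  apply/negP => /(connect_invariant invA); rewrite xA => /esym yA.
  exact: AB yA yB.
Qed.

Lemma node_cut_sides (G : sgraph) (C : {set G}) :
  1 < n_comp (edge_del C) (~: C) ->
  exists A B : {set G}, [/\ A != set0, B != set0, A :|: B = ~: C &
    forall x y, x \in A -> y \in B -> (x != y) && ~~ edge x y].
Proof.
move=> /card_gt1P[x [y [xR yR xy]]].
move: xR yR; rewrite !inE => /andP[/eqP xr xC] /andP[/eqP yr yC].
pose A := [set z in ~: C | connect (edge_del C) x z].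
exists A, (~: C :\: A); split.
- by apply/set0Pn; exists x; rewrite !inE xC connect0.
- apply/set0Pn; exists y; rewrite !inE yC /= andbT.
  apply: contra xy; rewrite -root_connect; last exact: edge_del_connect_sym.
  by rewrite xr yr.
- by apply/setP => z; rewrite !inE; case: (z \in C); case: (connect _ _ _).
move=> u v; rewrite !inE => /andP[uC xu] /andP[]; rewrite negb_and negbK => /orP[->//|nxv] vC.
apply/andP; split; first by apply: contraNneq nxv => <-.
apply: contra nxv => uv; apply: connect_trans xu _; apply: connect1.
by rewrite /edge_del /= uC vC.
Qed.

(** The projections of [A] and [B] are nonadjacent, so the nodes in neither form a node cut, and all
    [s] copies of each such node lie outside [A :|: B]. *)
Lemma blowup_separator (G : sgraph) s (A B : {set copies G s}) :
  A != set0 -> B != set0 -> nonadjacent (@blowup G s) A B ->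
  node_connectivity G * s <= #|~: (A :|: B)|.
Proof.
move=> /set0Pn[a aA] /set0Pn[b bB] /nonadjacentP nAB.
have cut : node_cut (~: (fst @: A :|: fst @: B)).
  apply: node_cut_of_sides.
  - by apply/set0Pn; exists a.1; apply: imset_f.
  - by apply/set0Pn; exists b.1; apply: imset_f.
  move=> _ _ /imsetP[x xA ->] /imsetP[y yB ->].
  by have := nAB x y xA yB; rewrite /blowup /= negb_or.
apply: leq_trans (leq_mul (node_connectivity_le cut) (leqnn s)) _.
rewrite -card_copies; apply/subset_leq_card/subsetP => x; rewrite !inE.
by apply: contra => /orP[xA|xB]; apply/orP; [left|right]; apply: imset_f.
Qed.

Lemma node_connectivity_max (G : sgraph) : 0 < #|G| -> node_connectivity G <= #|G|.
Proof. by case/node_connectivity_ex => C _ <-; apply: max_card. Qed.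

Lemma supply_cut_survivors M W : supply_node_cut (interdep M) W ->
  s1 < #|survivors M W| -> split_by_cut (@blowup G1 s1) (survivors M W).
Proof.
case/existsP => C /andP[cutC /subsetP sC] lt.
have survC a : a \in survivors M W -> a.1 \notin C.
  rewrite inE => /existsP[b /andP[abM bW]]; apply: contra bW => /sC.
  rewrite inE => /subsetP; apply; rewrite inE; apply/existsP; exists a.2.
  by apply/existsP; exists b.2; move: abM; case: (a) (b) => ? ? [? ?].
(* If the cut leaves a single node, the survivors are among its [s1] copies, against the size
   hypothesis. *)
case/orP: cutC => [/node_cut_sides[A [B [A0 B0 AB nAB]]]|/cards1P[x Cx]]; last first.
  have : #|survivors M W| <= #|[set x]| * s1.
    rewrite -card_copies; apply/subset_leq_card/subsetP => a /survC aC.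
    by rewrite inE -Cx inE.
  by rewrite cards1 mul1n leqNgt lt.
have s0 : 0 < s1.
  have /card_gt0P[a _] : 0 < #|survivors M W| by apply: leq_ltn_trans lt.
  by case: (a.2) => i; apply: leq_ltn_trans.
pose i0 := Ordinal s0.
apply/existsP; exists [set a | a.1 \in A]; apply/existsP; exists [set a | a.1 \in B].
apply/and4P; split.
- by case/set0Pn: A0 => x xA; apply/set0Pn; exists (x, i0); rewrite inE.
- by case/set0Pn: B0 => x xB; apply/set0Pn; exists (x, i0); rewrite inE.
- apply/nonadjacentP => x y; rewrite !inE => xA yB.
  by rewrite /blowup /= negb_or nAB.
- apply/subsetP => a /survC; rewrite !inE => aC.
  by have /setP/(_ a.1) := AB; rewrite !inE aC.
Qed.

Lemma supply_cut_mono M W W' : W \subset W' ->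
  supply_node_cut (interdep M) W -> supply_node_cut (interdep M) W'.
Proof.
move=> sW /existsP[C /andP[cutC sC]]; apply/existsP; exists C; rewrite cutC /=.
apply: subset_trans sC _; apply/subsetP => v; rewrite !inE => h.
exact: subset_trans h sW.
Qed.

Lemma supply_conn1_le M : perfect_matching M -> 0 < #|G1| ->
  supply_conn1 M <= minn (node_connectivity G1 * s1) #|G2|.
Proof.
move=> /perfect_matchingP[_ _ h3 _] G0; rewrite leq_min; apply/andP; split; last first.
  rewrite /supply_conn1; have [W _ <-] := supply_node_connectivity_ex (interdep M) G0.
  exact: max_card.
have [C cutC <-] := node_connectivity_ex G0.
pose P := [set p in M | p.1.1 \in C].
(* All nodes supplying a minimum node cut: one for each of its [node_connectivity G1 * s1] copies,
   possibly with repetitions. *)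
pose W := [set p.2.1 | p in P].
apply: (@leq_trans #|W|).
  apply: supply_node_connectivity_le; apply/existsP; exists C; rewrite cutC /=.
  apply/subsetP => v vC; rewrite inE; apply/subsetP => w; rewrite inE.
  move=> /existsP[a /existsP[b abM]]; apply/imsetP; exists ((v, a), (w, b)) => //.
  by rewrite inE abM.
apply: leq_trans (leq_imset_card _ _) _; rewrite -card_copies.
rewrite -(@card_in_imset _ _ fst); last first.
  move=> [a b] [a' b']; rewrite !inE => /andP[ab _] /andP[ab' _] /= aa'.
  by rewrite -aa' in ab' *; rewrite (h3 _ _ _ ab ab').
apply/subset_leq_card/subsetP => _ /imsetP[p + ->]; rewrite !inE.
by case/andP.
Qed.

End Survivors.

(** * Union bounds over supply cuts *)

Lemma card_half_supersets (T : finType) (W : {set T}) :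
  2 ^ (#|T| - #|W|) <=
  2 * #|[set W' : {set T} | (W \subset W') && (2 * #|W'| <= #|T| + #|W|)]|.
Proof.
set S := [set W' | _].
pose L := [set W' : {set T} | (W \subset W') && ~~ (2 * #|W'| <= #|T| + #|W|)].
have E : #|[set W' : {set T} | W \subset W']| = 2 ^ (#|T| - #|W|).
  have -> : #|T| - #|W| = #|~: W| by rewrite -(cardsC W) addKn.
  rewrite -card_powerset -(card_imset _ (can_inj (@setCK T))); apply: eq_card => X.
  apply/imsetP/idP => [[Y + ->]|]; rewrite !inE; first by rewrite setCS.
  by move=> sX; exists (~: X); [rewrite inE subsetC|rewrite setCK].
rewrite -E.
have -> : #|[set W' : {set T} | W \subset W']| = #|S| + #|L|.
  rewrite -(cardsID [set W' : {set T} | 2 * #|W'| <= #|T| + #|W|]).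
  by congr (_ + _); apply: eq_card => X; rewrite !inE // andbC.
suff : #|L| <= #|S| by lia.
(* Complementation outside [W] is an involution on the supersets of [W]; it takes those above the
   mean size [(#|T| + #|W|) / 2] to ones below it. *)
have compl (X : {set T}) : W \subset X -> W :|: ~: (W :|: ~: X) = X.
  move=> sX; rewrite setCU setCK setUIr setUCr setTI; exact/setUidPr.
have inj : {in L &, injective (fun X => W :|: ~: X)}.
  move=> X Y; rewrite !inE => /andP[sX _] /andP[sY _] /= h.
  by rewrite -(compl X sX) -(compl Y sY) h.
rewrite -(card_in_imset inj); apply/subset_leq_card/subsetP => _ /imsetP[X + ->].
rewrite !inE subsetUl /= => /andP[sX big].
have c : #|W :|: ~: X| = #|W| + #|~: X|.
  rewrite cardsU; suff -> : W :&: ~: X = set0 by rewrite cards0 subn0.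
  by apply/eqP; rewrite setI_eq0 disjoints_subset setCK.
move: big (cardsC X); rewrite -ltnNge c.
by move: #|_| #|_| #|_| #|_| => x y z t; lia.
Qed.

Section UnionBounds.
Variables (G1 G2 : sgraph) (s1 s2 : nat) (R : realFieldType).
Local Notation C1 := (copies G1 s1).
Local Notation matching := (matching G1 G2 s1 s2).
Local Open Scope ring_scope.
Implicit Types (M : matching) (W : {set G2}).

Definition perfect_count (E : pred matching) : nat :=
  #|[set M | perfect_matching M & E M]%SET|.

Local Notation cut W := (fun M => supply_node_cut (interdep M) W).
Local Notation all_count := #|[set M : matching | perfect_matching M]%SET|.

Lemma perfect_count_cut W (d : R) :
  (#|G2| * s2 = #|G1| * s1)%N -> (s1 < (#|G2| - #|W|) * s2)%N ->
  #|[set U : {set C1} | (#|U| == (#|G2| - #|W|) * s2)%N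
     && split_by_cut (@blowup G1 s1) U]|%:R <= d * 'C(#|C1|, (#|G2| - #|W|) * s2)%:R ->
  (perfect_count (cut W))%:R <= d * all_count%:R.
Proof.
set T := ((_ - _) * s2)%N => cE sT hd.
have cC : #|C1| = (#|G1| * s1)%N by rewrite card_prod card_ord.
have TN : (T <= #|C1|)%N by rewrite cC -cE leq_mul2r leq_subr orbT.
have := card_survivors_pred (split_by_cut (@blowup G1 s1)) TN; rewrite -/T => E.
have Cp : 0 < 'C(#|C1|, T)%:R :> R by rewrite ltr0n bin_gt0.
rewrite -(ler_pM2r Cp).
apply: (@le_trans _ _ (all_count * #|[set U : {set C1} | (#|U| == T)%N
     && split_by_cut (@blowup G1 s1) U]|)%:R); last first.
  by rewrite natrM mulrAC mulrC ler_wpM2r.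
rewrite -E -natrM ler_nat leq_mul2r; apply/orP; right.
apply/subset_leq_card/subsetP => M; rewrite !inE => /andP[pM cutM]; rewrite pM /=.
by apply: supply_cut_survivors; rewrite // card_survivors.
Qed.

Lemma perfect_count_union (P : pred {set G2}) (E : pred matching) (d : R) :
  0 <= d -> (forall W, P W -> (perfect_count (cut W))%:R <= d * all_count%:R) ->
  (forall M, perfect_matching M -> E M ->
     exists2 W, supply_node_cut (interdep M) W & P W) ->
  (perfect_count E)%:R <= 2 ^+ #|G2| * d * all_count%:R.
Proof.
move=> d0 hd hE.
apply: (@le_trans _ _ (\sum_(W : {set G2} | P W) perfect_count (cut W))%:R).
  rewrite ler_nat; apply: leq_trans (card_bigcup_le _ _).
  apply/subset_leq_card/subsetP => M; rewrite inE => /andP[pM EM].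
  have [W cW PW] := hE M pM EM; apply/bigcupP; exists W => //.
  by rewrite inE pM.
rewrite natr_sum; apply: (@le_trans _ _ (\sum_(W : {set G2} | P W) d * all_count%:R)).
  by apply: ler_sum.
rewrite sumr_const -[leLHS]mulr_natl -mulrA ler_wpM2r ?mulr_ge0 //.
rewrite -natrX ler_nat; apply: leq_trans (max_card _) _.
by rewrite -cardsT -powersetT card_powerset cardsT.
Qed.

(* Every superset of a supply cut [W] is one, so a cut of size [w] produces at
   least [2 ^ (m - w - 1)] cuts of size at most [3 m / 4]; this makes the union
   bound over all sets cost [2 ^ w.+1] instead of ['C(m, w)]. *)
Lemma perfect_count_small_cut (E : pred matching) (w : nat) (d : R) :
  (2 * w <= #|G2|)%N ->
  (forall W, (4 * #|W| <= 3 * #|G2|)%N -> (perfect_count (cut W))%:R <= d * all_count%:R) ->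
  (forall M, perfect_matching M -> E M ->
     exists2 W, supply_node_cut (interdep M) W & (#|W| <= w)%N) ->
  (perfect_count E)%:R <= 2 ^+ w.+1 * d * all_count%:R.
Proof.
move=> wm hd hE.
have hd0 : 0 <= d * all_count%:R :> R.
  by apply: le_trans (hd set0 _); rewrite ?ler0n // cards0 muln0.
pose P := [pred W : {set G2} | (4 * #|W| <= 3 * #|G2|)%N].
(* Count pairs of a bad matching and a small supply cut. Since [#|W| <= #|G2| / 2], the supersets of
   at most mean size have at most [3 / 4 * #|G2|] elements. *)
have key : (perfect_count E * 2 ^ (#|G2| - w) <=
    2 * \sum_(W : {set G2} | P W) perfect_count (cut W))%N.
  rewrite /perfect_count -sum_nat_const.
  under [X in (_ <= 2 * X)%N]eq_bigr do rewrite -sum1_card.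
  rewrite (exchange_big_dep (mem [set M : matching | perfect_matching M]%SET)) /=; last first.
    by move=> W M _; rewrite !inE => /andP[].
  rewrite big_distrr /= [leqLHS]big_mkcond [leqRHS]big_mkcond /=; apply: leq_sum => M _.
  rewrite !inE; have [pM|] := boolP (perfect_matching M) => //=.
  case: ifP => [EM|//]; have [W cW Ww] := hE M pM EM.
  apply: (@leq_trans (2 ^ (#|G2| - #|W|))); first by rewrite leq_pexp2l // leq_sub2l.
  apply: leq_trans (card_half_supersets W) _; rewrite leq_mul2l /=.
  rewrite -[leqLHS]sum1_card [leqLHS]big_mkcond [leqRHS]big_mkcond /=; apply: leq_sum => W' _.
  rewrite !inE pM /=; case: ifP => // /andP[sW small].
  rewrite (supply_cut_mono sW cW) andbT.
  by have -> : (4 * #|W'| <= 3 * #|G2|)%N by move: small Ww wm; clear; move: #|_| #|_| #|_| => *; lia.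
have p2 : 0 < 2 ^+ (#|G2| - w) :> R by rewrite exprn_gt0.
rewrite -(ler_pM2r p2) -natrX -natrM.
apply: (@le_trans _ _ (2 * \sum_(W : {set G2} | P W) perfect_count (cut W))%:R).
  by rewrite ler_nat.
rewrite natrM natr_sum.
apply: (@le_trans _ _ (2 * (2 ^+ #|G2| * (d * all_count%:R)))).
  rewrite ler_wpM2l //.
  apply: (@le_trans _ _ (\sum_(W : {set G2} | P W) d * all_count%:R)).
    by apply: ler_sum => W; apply: hd.
  rewrite sumr_const -[leLHS]mulr_natl ler_wpM2r //.
  rewrite -natrX ler_nat; apply: leq_trans (max_card _) _.
  by rewrite -cardsT -powersetT card_powerset cardsT.
have e1 : (w + (#|G2| - w) = #|G2|)%N by lia.
rewrite le_eqVlt; apply/orP; left; apply/eqP.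
rewrite natrX -{1}e1 exprD exprS; ring.
Qed.

End UnionBounds.

(** * Exchanging the two graphs *)

Section Transpose.
Variables (G1 G2 : sgraph) (s1 s2 : nat).

Definition transpose (M : matching G1 G2 s1 s2) : matching G2 G1 s2 s1 :=
  [set p | (p.2, p.1) \in M].

Lemma transpose_perfect M : perfect_matching (transpose M) = perfect_matching M.
Proof.
rewrite /perfect_matching andbC; congr (_ && _); apply: eq_forallb => a;
  by congr (_ == 1); apply: eq_card => b; rewrite !inE.
Qed.

Lemma transpose_conn2 M : supply_conn2 M = supply_conn1 (transpose M).
Proof.
have E w v : interdep M v w = interdep (transpose M) w v.
  apply/existsP/existsP => -[a /existsP[b h]]; exists b; apply/existsP; exists a;
    by move: h; rewrite inE.
rewrite /supply_conn2 /supply_conn1 /supply_node_connectivity.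
have fE W : failed_nodes (fun w v => interdep M v w) W =
            failed_nodes (interdep (transpose M)) W.
  apply/setP => v; rewrite !inE; apply: eq_subset => w.
  by rewrite !inE E.
by apply: eq_bigl => W; apply: eq_existsb => C; rewrite fE.
Qed.

End Transpose.

Lemma transposeK G1 G2 s1 s2 : cancel (@transpose G1 G2 s1 s2) (@transpose G2 G1 s2 s1).
Proof. by move=> M; apply/setP => -[a b]; rewrite !inE. Qed.

Lemma card_transpose G1 G2 s1 s2 (E : pred (matching G2 G1 s2 s1)) :
  #|[set M | perfect_matching M & E M]| =
  #|[set M : matching G1 G2 s1 s2 | perfect_matching M & E (transpose M)]|.
Proof.
rewrite -(card_imset _ (can_inj (@transposeK G2 G1 s2 s1))); apply: eq_card => M.
apply/imsetP/idP => [[M' + ->]|]; rewrite !inE.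
  by rewrite transpose_perfect transposeK.
by move=> h; exists (transpose M); rewrite ?transposeK // inE transpose_perfect.
Qed.

(** * Asymptotics *)

From mathcomp Require Import all_classical all_reals all_analysis.
Import Order.TTheory GRing.Theory Num.Theory.
Import numFieldNormedType.Exports.
Local Open Scope ring_scope.

Lemma one_sub_le_expR (R : realType) (x : R) : 1 - x <= expR (- x).
Proof. exact: expR_ge1Dx. Qed.

Lemma card_split_by_cut_exp (R : realType) (V : finType) (e : rel V) (K T : nat) (p : R) :
  symmetric e -> reflexive e -> (K <= #|V|)%N ->
  (forall A B : {set V}, A != finset.set0 -> B != finset.set0 -> nonadjacent e A B ->
     (K <= #|~: (A :|: B)|)%N) ->
  (4 <= T)%N -> (T <= #|V|)%N -> 0 <= p -> p * #|V|%:R <= T%:R ->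
  #|[set U : {set V} | (#|U| == T)%N && split_by_cut e U]%SET|%:R <=
  2 * #|V|%:R * expR (- (p ^+ 2 / 256 * K%:R)) * 'C(#|V|, T)%:R :> R.
Proof.
move=> e_sym e_refl KV sepP T4 TV p0 pT.
(* As [4 <= T], one gets [q >= T / 8], so [u = q / N] is at least [p / 8] and the decay exponent
   [u ^ 2 / 4] is at least [p ^ 2 / 256]. The domination exponent is at least [u], which is larger
   because [u <= 1]. *)
pose q := (T %/ 4)%N; pose l0 := (T - 3 * q)%N.
have TE : T = (l0 + 3 * q)%N by rewrite /l0 /q; lia.
have q0 : (0 < q)%N by rewrite /q; lia.
have ql0 : (q <= l0)%N by rewrite /l0 /q; lia.
have q8 : (T <= 8 * q)%N by rewrite /q; lia.
set N := #|V|.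
have N0 : 0 < N%:R :> R by rewrite ltr0n /N; lia.
pose x : R := (q * K)%:R / (4 * N ^ 2)%:R.
have h := @card_split_by_cut V e e_sym e_refl K KV sepP R l0 q (expR (- x)) q0.
have TV' : (l0 + 3 * q <= N)%N by rewrite -TE.
have {}h := h TV' (expR_ge0 _) (one_sub_le_expR _).
rewrite -TE -/N in h.
apply: (le_trans h); rewrite ler_wpM2r //
  -[leRHS]mulrA [leRHS]mulrCA ler_wpM2l //.
have pq : p / 8 <= q%:R / N%:R.
  rewrite ler_pdivlMr // mulrAC ler_pdivrMr //; apply: (le_trans pT).
  by rewrite -natrM ler_nat mulnC.
have q1 : q%:R / N%:R <= 1 :> R.
  by rewrite ler_pdivrMr // mul1r ler_nat /N; lia.
have l1 : q%:R / N%:R <= l0%:R / N%:R :> R by rewrite ler_pM2r ?invr_gt0 // ler_nat.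
set u : R := q%:R / N%:R in pq q1 l1.
have u0 : 0 <= u by rewrite divr_ge0.
have pu : p ^+ 2 / 256 <= u ^+ 2 / 4 by nra.
have xq : x * q%:R = u ^+ 2 / 4 * K%:R.
  rewrite /x /u !natrM; field; exact: lt0r_neq0.
have b1 : (1 - l0%:R / N%:R) ^+ K <= expR (- (p ^+ 2 / 256 * K%:R)).
  apply: (@le_trans _ _ (expR (- (l0%:R / N%:R)) ^+ K)).
    rewrite lerXn2r ?nnegrE ?expR_ge0 ?one_sub_le_expR //.
    by rewrite subr_ge0 ler_pdivrMr // mul1r ler_nat (leq_trans (leq_subr _ _)).
  rewrite -expRM_natr ler_expR mulNr lerN2 ler_wpM2r //.
  by apply: le_trans l1; nra.
have b2 : expR (- x) ^+ q <= expR (- (p ^+ 2 / 256 * K%:R)).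
  by rewrite -expRM_natr ler_expR mulNr lerN2 xq ler_wpM2r.
by apply: (le_trans (lerD b1 b2)); rewrite -mulr2n mulr_natl.
Qed.

Local Notation cut W := (fun M => supply_node_cut (interdep M) W).
Local Notation all_count G1 G2 s1 s2 :=
  #|[set M : matching G1 G2 s1 s2 | perfect_matching M]%SET|.

Lemma perfect_count_cut_exp (R : realType) (G1 G2 : sgraph) (s1 s2 : nat) (p : R)
    (W : {set G2}) :
  (#|G1| * s1 = #|G2| * s2)%N -> (0 < s1)%N -> 0 < p -> 4 <= p * #|G1|%:R ->
  p * #|G2|%:R <= #|G2|%:R - #|W|%:R ->
  (perfect_count (G1 := G1) (s1 := s1) (s2 := s2) (cut W))%:R <=
  2 * (#|G1| * s1)%N%:R * expR (- (p ^+ 2 / 256 * (node_connectivity G1 * s1)%N%:R))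
    * (all_count G1 G2 s1 s2)%:R.
Proof.
move=> cE s0 p0 pn pW.
have WG : (#|W| <= #|G2|)%N by apply: max_card.
set T := ((#|G2| - #|W|) * s2)%N.
have cC : #|copies G1 s1| = (#|G1| * s1)%N by rewrite card_prod card_ord.
have G0 : (0 < #|G1|)%N.
  by rewrite lt0n; apply/eqP => E; move: pn; rewrite E mulr0; lra.
have s0' : 1 <= s1%:R :> R by rewrite ler1n.
have pT : p * (#|G1| * s1)%N%:R <= T%:R.
  rewrite cE /T !natrM natrB // mulrA.
  by rewrite ler_wpM2r.
(* At least [4 * s1] survivors: enough to exclude cuts leaving one node, and to form batches with
   [q > 0]. *)
have T4s : 4 * s1%:R <= T%:R :> R.
  apply: le_trans pT; rewrite natrM mulrA ler_wpM2r //.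
have T4 : (4 * s1 <= T)%N by rewrite -(ler_nat R) natrM.
apply: perfect_count_cut; [by rewrite cE|by rewrite -/T; lia|].
rewrite -/T -cC; apply: card_split_by_cut_exp.
- exact: blowup_sym.
- exact: blowup_refl.
- by rewrite cC leq_mul2r node_connectivity_max // orbT.
- by move=> A B; apply: blowup_separator.
- lia.
- by rewrite cC cE leq_mul2r leq_subr orbT.
- exact: ltW.
- by rewrite cC.
Qed.

(** Eventually [ln N <= b / 2 * K] with [N] the number of copies, so the exponential is at most
    [N ^ -2] and the failure probability at most [a / N]. *)
Lemma whp_of_count (R : realType) (G1 G2 : nat -> sgraph) (s1 s2 K : nat -> nat)
    (E : forall t, pred (matching (G1 t) (G2 t) (s1 t) (s2 t))) (a b : R) :
  (#|G1 t| @[t --> \oo] --> \oo)%classic ->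
  (forall t, (0 < s1 t)%N) -> (forall t, (#|G1 t| * s1 t = #|G2 t| * s2 t)%N) ->
  little_omega (fun t => (K t)%:R : R) (fun t => ln ((#|G1 t| * s1 t)%N%:R : R)) ->
  0 < a -> 0 < b ->
  (\forall t \near \oo%classic, (perfect_count (predC (E t)))%:R <=
     a * (#|G1 t| * s1 t)%N%:R * expR (- (b * (K t)%:R)) *
     (all_count (G1 t) (G2 t) (s1 t) (s2 t))%:R) ->
  whp R G1 G2 s1 s2 E.
Proof.
move=> n1_oo s0 cE /little_omegaP om a0 b0 hcount.
apply/cvgrPdist_le => eps eps0.
have b2 : 0 < b / 2 by rewrite divr_gt0.
near=> t.
have hc : (perfect_count (predC (E t)))%:R <=
     a * (#|G1 t| * s1 t)%N%:R * expR (- (b * (K t)%:R)) *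
     (all_count (G1 t) (G2 t) (s1 t) (s2 t))%:R by near: t.
have hK : `|ln ((#|G1 t| * s1 t)%N%:R : R)| <= b / 2 * `|(K t)%:R| by near: t; apply: om.
have hn : a / eps + 1 <= (#|G1 t|)%:R by near: t; apply: (n1_oo _ (nbhs_infty_ger (a / eps + 1))).
set N := (#|G1 t| * s1 t)%N in hc hK.
have nN : a / eps + 1 <= N%:R.
  by apply: le_trans hn _; rewrite ler_nat /N leq_pmulr.
have aeps : 0 < a / eps by rewrite divr_gt0.
have N1 : 1 <= N%:R :> R by lra.
have N0 : 0 < N%:R :> R by lra.
set P := all_count _ _ _ _ in hc.
have P0 : 0 < P%:R :> R.
  by rewrite ltr0n exists_perfect_matching // !card_prod !card_ord.
have PE : (P = perfect_count (E t) + perfect_count (predC (E t)))%N.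
  rewrite /P -(cardsID [set M | E t M]%SET).
  by congr (_ + _)%N; apply: eq_card => M; rewrite !inE // andbC.
have -> : 1 - matching_prob R (E t) = (perfect_count (predC (E t)))%:R / P%:R.
  rewrite /matching_prob -/P -/(perfect_count (E t)) -{1}(divff (lt0r_neq0 P0)) -mulrBl.
  by rewrite {1}PE natrD addrAC subrr add0r.
rewrite ger0_norm ?divr_ge0 // ler_pdivrMr //; apply: (le_trans hc).
rewrite ler_wpM2r //.
have hexp : expR (- (b * (K t)%:R)) <= (N%:R ^+ 2)^-1.
  rewrite expRN lef_pV2 ?posrE ?exprn_gt0 ?expR_gt0 //.
  have -> : N%:R ^+ 2 = expR (ln N%:R * 2%:R) :> R.
    by rewrite expRM_natr lnK.
  rewrite ler_expR.
  have : ln N%:R <= b / 2 * (K t)%:R.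
    by apply: le_trans (ler_norm _) _; apply: le_trans hK _; rewrite ger0_norm.
  lra.
apply: (@le_trans _ _ (a * N%:R * (N%:R ^+ 2)^-1)).
  by rewrite ler_wpM2l // mulr_ge0 // ltW.
have -> : a * N%:R * (N%:R ^+ 2)^-1 = a / N%:R by field; exact: lt0r_neq0.
rewrite ler_pdivrMr // mulrC -ler_pdivrMr //; lra.
Unshelve. all: by end_near.
Qed.

Lemma expR_ge_pow2 (R : realType) (n : nat) : 2 ^+ n <= expR n%:R :> R.
Proof.
rewrite -[n%:R]mul1r expRM_natr lerXn2r ?nnegrE ?expR_ge0 //.
by have := expR_ge1Dx (1 : R); lra.
Qed.

Lemma supply_conn1_whp (R : realType) (G1 G2 : nat -> sgraph) (s1 s2 : nat -> nat)
  (n1_oo : (#|G1 t| @[t --> \oo] --> \oo)%classic)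
  (s1_gt0 : forall t, (0 < s1 t)%N)
  (copies_eq : forall t, (#|G1 t| * s1 t = #|G2 t| * s2 t)%N) :
  let k1s1 t := (node_connectivity (G1 t) * s1 t)%N in
  little_omega (fun t => (k1s1 t)%:R : R)
                (fun t => ln ((#|G1 t| * s1 t)%N%:R : R)) ->
  (exists c C : R, [/\ 0 < c, 0 < C &
     whp R G1 G2 s1 s2 (fun t M =>
      c * (minn (k1s1 t) #|G2 t|)%:R <= (supply_conn1 M)%:R
        <= C * (minn (k1s1 t) #|G2 t|)%:R)])
  /\
  (little_omega (fun t => (k1s1 t)%:R : R) (fun t => #|G2 t|%:R : R) ->
   forall eps : R, 0 < eps ->
        whp R G1 G2 s1 s2 (fun t M =>
          (1 - eps) * #|G2 t|%:R <= (supply_conn1 M)%:R)).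
Proof.
have double (a b : R) : a <= b -> 2 * a <= b + b by move=> ?; lra.
have quarter (a b : R) : 4 * a <= 3 * b -> 4^-1 * b <= b - a by move=> ?; lra.
have collect (x y z : R) : 2 * x * (2 * z * (y * y)) = 4 * z * y * (x * y) by ring.
move=> k1s1 om; split.
  (* Sets of at most three quarters of [G2] leave a proportion [p = 1 / 4], with exponent
     [p ^ 2 / 256 = 2 c]. The factor [2 ^ w] of the union bound, with [w <= c * K], consumes one
     half of it. *)
  have [c cE [c0 c2]] : exists2 c : R, 4^-1 ^+ 2 / 256 = c + c & 0 < c /\ c + c <= 1.
    by exists (4^-1 ^+ 2 / 256 / 2); lra.
  exists c, 1; split=> //.
  apply: (@whp_of_count R G1 G2 s1 s2 k1s1 _ 4 c) => //.
  near=> t.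
  (* This is the condition [4 <= p * #|G1 t|] for [p = 1 / 4]. *)
  have n16 : (16 <= #|G1 t|)%N by near: t; apply: (n1_oo _ (nbhs_infty_ge 16)).
  have G0 : (0 < #|G1 t|)%N by apply: leq_trans n16.
  set E := predC _; set K := k1s1 t; set m := minn K #|G2 t|.
  have cm0 : 0 <= c * m%:R by rewrite mulr_ge0 // ltW.
  pose w := Num.truncn (c * m%:R).
  have wle : w%:R <= c * m%:R by rewrite truncn_le.
  pose d : R := 2 * (#|G1 t| * s1 t)%N%:R * expR (- ((c + c) * K%:R)).
  have h := @perfect_count_small_cut (G1 t) (G2 t) (s1 t) (s2 t) R E w d.
  apply: le_trans (h _ _ _) _.
  - rewrite -(ler_nat R) natrM.
    apply: (@le_trans _ _ ((c + c) * m%:R)); first by rewrite [leRHS]mulrDl; apply: double.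
    apply: (@le_trans _ _ m%:R); last by rewrite ler_nat geq_minr.
    by rewrite ler_piMl.
  - move=> W W34; rewrite /d -cE; apply: perfect_count_cut_exp => //.
      by rewrite ler_pdivlMl // -natrM ler_nat.
    by apply: quarter; rewrite -!natrM ler_nat.
  - move=> M pM; rewrite /E /= mul1r ler_nat (supply_conn1_le pM G0) andbT -ltNge.
    have [W cW WE] := supply_node_connectivity_ex (interdep M) G0.
    rewrite /supply_conn1 -WE => lt; exists W => //.
    by rewrite /w truncn_ge_nat // ltW.
  rewrite ler_wpM2r //.
  have hw : 2 ^+ w <= expR (c * K%:R) :> R.
    apply: le_trans (expR_ge_pow2 R w) _; rewrite ler_expR; apply: (le_trans wle).
    by rewrite ler_wpM2l ?(ltW c0) // ler_nat geq_minl.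
  rewrite exprS /d [(c + c) * _]mulrDl opprD expRD.
  have e1 : expR (c * K%:R) * expR (- (c * K%:R)) = 1 :> R.
    by rewrite expRN divff // lt0r_neq0 // expR_gt0.
  set y := expR (- _) in e1 *; set N := (_ * _)%N.
  have y0 : 0 <= y by apply: expR_ge0.
  have wy : 2 ^+ w * y <= 1 by rewrite -[leRHS]e1 ler_wpM2r.
  rewrite collect.
  by rewrite ler_piMr // !mulr_ge0.
move=> om2 eps eps0.
(* A set [W] smaller than [(1 - eps) * #|G2 t|] leaves a proportion [eps]. Since eventually
   [#|G2 t| <= b / 2 * K], the number [2 ^ #|G2 t|] of sets consumes at most half of the exponent
   [b * K]. *)
pose b := eps ^+ 2 / 256.
have b0 : 0 < b by rewrite divr_gt0 ?exprn_gt0 ?ltr0n.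
have b20 : 0 < b / 2 by rewrite divr_gt0.
apply: (@whp_of_count R G1 G2 s1 s2 k1s1 _ 2 (b / 2)) => //.
near=> t.
have n4 : 4 / eps <= #|G1 t|%:R.
  by near: t; apply: (n1_oo _ (nbhs_infty_ger (4 / eps))).
have hm : `|#|G2 t|%:R : R| <= b / 2 * `|(k1s1 t)%:R|.
  by near: t; have /little_omegaP := om2; apply.
rewrite !ger0_norm // in hm.
have en : 4 <= eps * #|G1 t|%:R by rewrite mulrC -ler_pdivrMr.
have G0 : (0 < #|G1 t|)%N.
  by rewrite lt0n; apply/eqP => E; move: en; rewrite E mulr0; lra.
set E := predC _; set K := k1s1 t in hm *.
pose d : R := 2 * (#|G1 t| * s1 t)%N%:R * expR (- (b * K%:R)).
have d0 : 0 <= d by rewrite !mulr_ge0 // expR_ge0.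
have h := @perfect_count_union (G1 t) (G2 t) (s1 t) (s2 t) R
  [pred W : {set G2 t} | #|W|%:R < (1 - eps) * #|G2 t|%:R] E d d0.
apply: le_trans (h _ _) _.
- move=> W /= hW; apply: perfect_count_cut_exp => //.
  lra.
- move=> M pM; rewrite /E /= -ltNge.
  have [W cW WE] := supply_node_connectivity_ex (interdep M) G0.
  by rewrite /supply_conn1 -WE => lt; exists W.
rewrite ler_wpM2r // /d.
rewrite [leLHS]mulrCA ler_wpM2l ?mulr_ge0 //.
apply: (@le_trans _ _ (expR #|G2 t|%:R * expR (- (b * K%:R)))).
  by rewrite ler_wpM2r ?expR_ge0 ?expR_ge_pow2.
by rewrite -expRD ler_expR; lra.
Unshelve. all: by end_near.
Qed.

Lemma whp_transpose (R : realType) (G1 G2 : nat -> sgraph) (s1 s2 : nat -> nat)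
    (Q : nat -> pred nat) :
  whp R G2 G1 s2 s1 (fun t M => Q t (supply_conn1 M)) ->
  whp R G1 G2 s1 s2 (fun t M => Q t (supply_conn2 M)).
Proof.
rewrite /whp => h; rewrite (_ : (fun t => _) = (fun t =>
  matching_prob R (fun M : matching (G2 t) (G1 t) (s2 t) (s1 t) => Q t (supply_conn1 M)))) //.
apply/funext => t; rewrite /matching_prob.
rewrite (@card_transpose (G1 t) (G2 t) (s1 t) (s2 t)).
congr (_%:R / _%:R).
  by apply: eq_card => M; rewrite !inE transpose_conn2.
have := @card_transpose (G1 t) (G2 t) (s1 t) (s2 t) predT.
have E G G' s s' : #|[set M : matching G G' s s' | perfect_matching M & true]%SET| =
   #|[set M : matching G G' s s' | perfect_matching M]%SET|.
  by apply: eq_card => M; rewrite !inE andbT.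
by rewrite /= !E.
Qed.

Unset Implicit Arguments.
Local Open Scope classical_set_scope.

Theorem theorem9 (R : realType) (G1 G2 : nat -> sgraph) (s1 s2 : nat -> nat)
  (n1_oo : #|G1 t| @[t --> \oo] --> \oo)
  (n2_oo : #|G2 t| @[t --> \oo] --> \oo)
  (s1_gt0 : forall t, (0 < s1 t)%N)
  (s2_gt0 : forall t, (0 < s2 t)%N)
  (copies_eq : forall t, (#|G1 t| * s1 t = #|G2 t| * s2 t)%N) :
  let k1s1 t := (node_connectivity (G1 t) * s1 t)%N in
  let k2s2 t := (node_connectivity (G2 t) * s2 t)%N in
  (little_omega (fun t => (k1s1 t)%:R : R)
                (fun t => ln ((#|G1 t| * s1 t)%N%:R : R)) ->
     (exists c C : R, [/\ 0 < c, 0 < C &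
        whp R G1 G2 s1 s2 (fun t M =>
          c * (minn (k1s1 t) #|G2 t|)%:R <= (supply_conn1 M)%:R
            <= C * (minn (k1s1 t) #|G2 t|)%:R)])
     /\
     (little_omega (fun t => (k1s1 t)%:R : R) (fun t => #|G2 t|%:R : R) ->
      forall eps : R, 0 < eps ->
        whp R G1 G2 s1 s2 (fun t M =>
          (1 - eps) * #|G2 t|%:R <= (supply_conn1 M)%:R)))
  /\
  (little_omega (fun t => (k2s2 t)%:R : R)
                (fun t => ln ((#|G2 t| * s2 t)%N%:R : R)) ->
     (exists c C : R, [/\ 0 < c, 0 < C &
        whp R G1 G2 s1 s2 (fun t M =>
          c * (minn (k2s2 t) #|G1 t|)%:R <= (supply_conn2 M)%:R
            <= C * (minn (k2s2 t) #|G1 t|)%:R)])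
     /\
     (little_omega (fun t => (k2s2 t)%:R : R) (fun t => #|G1 t|%:R : R) ->
      forall eps : R, 0 < eps ->
        whp R G1 G2 s1 s2 (fun t M =>
          (1 - eps) * #|G1 t|%:R <= (supply_conn2 M)%:R))).
Proof.
move=> k1s1 k2s2.
have copies_eq' t : (#|G2 t| * s2 t = #|G1 t| * s1 t)%N by rewrite copies_eq.
split=> om; first exact: supply_conn1_whp.
(* The second half is the first with the graphs exchanged, carried back by transposing matchings. *)
have [[c [C [c0 C0 h1]]] h2] := supply_conn1_whp n2_oo s2_gt0 copies_eq' om; split.
  exists c, C; split=> //.
  exact: (whp_transpose (Q := fun t x =>
    c * (minn (k2s2 t) #|G1 t|)%:R <= x%:R <= C * (minn (k2s2 t) #|G1 t|)%:R)).
move=> om2 eps eps0.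
exact: (whp_transpose (Q := fun t x => (1 - eps) * #|G1 t|%:R <= x%:R)
  (h2 om2 eps eps0)).
Qed.
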